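(* If $\beta\geq-1/3$, then $$\ell_{n+1}^{(\beta)}>\ell_n^{(\beta)}\qquad\text{for every integer } n\geq0,$$ where $\ell_n^{(\beta)}=\int_{-1}^1\bigl|K_n^{(0,\beta)}(1,t)\bigr|(1+t)^\beta\,dt$.
   Context: $P_n^{(\alpha,\beta)}$ is the Jacobi polynomial of degree $n$ normalised by $P_n^{(\alpha,\beta)}(1)=(\alpha+1)_n/n!$. For $\beta>-1$ let $h_j^{(0,\beta)}=\int_{-1}^1 P_j^{(0,\beta)}(t)^2(1+t)^\beta\,dt$ and $$K_n^{(0,\beta)}(x,t)=\sum_{j=0}^n\frac{P_j^{(0,\beta)}(x)P_j^{(0,\beta)}(t)}{h_j^{(0,\beta)}}.$$ Thus $\ell_n^{(\beta)}$ is the value at $x=1$ of the Lebesgue function $\lambda_n^{(0,\beta)}(x)=\int_{-1}^1|K_n^{(0,\beta)}(x,t)|(1+t)^\beta\,dt$. *)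

(* Defs.v *)
From mathcomp Require Import all_boot all_order all_algebra.
From mathcomp Require Import all_classical all_reals all_analysis.
Set Implicit Arguments.
Unset Strict Implicit.
Unset Printing Implicit Defensive.
Import Order.TTheory GRing.Theory Num.Theory.
Local Open Scope classical_set_scope.
Local Open Scope ring_scope.

(* Pochhammer symbol (a)_n = a (a + 1) ... (a + n - 1). *)
Definition rising (R : realType) (a : R) (n : nat) : R :=
  \prod_(i < n) (a + i%:R).

(* The hypergeometric formula
     P_n^(a,b)(x) = (a+1)_n / n! * 2F1(-n, n+a+b+1; a+1; (1-x)/2),
   in which (a+1)_n / (a+1)_k is simplified to (a+k+1)_(n-k). *)
Definition jacobi (R : realType) (a b : R) (n : nat) : {poly R} :=
  \sum_(k < n.+1)
    (rising (n%:R + a + b + 1) k * rising (a + k%:R + 1) (n - k)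
       / (k`!%:R * (n - k)`!%:R)) *: (2^-1 *: ('X - 1)) ^+ k.

Lemma jacobi_at1 (R : realType) (a b : R) (n : nat) :
  (jacobi a b n).[1] = rising (a + 1) n / n`!%:R.
Proof.
rewrite /jacobi horner_sum (bigD1 ord0) //= big1 => [|i i0].
  by rewrite !hornerE /rising big_ord0 subn0 ?addr0 ?mul1r ?mulr1.
have /negPf i0' : i != 0 :> nat by [].
by rewrite hornerZ horner_exp hornerZ !hornerE subrr mulr0 expr0n i0' mulr0.
Qed.

(* For b < 0 the library's convention 0 `^ b = 0 affects the weight
   (1 + t) `^ b only at the point t = -1, which is a null set. *)
Definition jacobi_h (R : realType) (b : R) (j : nat) : R :=
  \int[lebesgue_measure]_(t in `[-1, 1])
    ((jacobi 0 b j).[t] ^+ 2 * (1 + t) `^ b).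

Definition jacobi_kernel (R : realType) (b : R) (n : nat) (x t : R) : R :=
  \sum_(j < n.+1) (jacobi 0 b j).[x] * (jacobi 0 b j).[t] / jacobi_h b j.

Definition jacobi_lebesgue_fun (R : realType) (b : R) (n : nat) (x : R) : R :=
  \int[lebesgue_measure]_(t in `[-1, 1])
    (`|jacobi_kernel b n x t| * (1 + t) `^ b).

Definition ell (R : realType) (b : R) (n : nat) : R :=
  jacobi_lebesgue_fun b n 1.

(* Main.v *)
(** Put [g = beta + 1], [Q_n = P_n^(0,g)] and [F_n = (1 + t)^g Q_n].  The kernel
    at [x = 1] satisfies [K_n(1,t) (1 + t)^beta = 2^(-g) F_n'(t)], so [2^g l_n] is
    the total variation of [F_n], that is [2^g] plus twice the sum of the
    absolute values of [F_n] at its critical points.  With [t = cos theta] and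
    [l^2 = (n + 1)(n + g)], [F_n] solves the damped oscillator equation
    [F'' + F' / m + l^2 F = 0] with [m = sin theta / (g + (1 - g) cos theta)].
    In terms of the Pruefer angle [psi] the damping is governed by [c = l m]
    alone, and at equal [psi] a larger [l] has a larger [c]: where the two
    values of [c] meet, the larger [l] has the larger derivative, because [m] is
    concave up to its maximum.  Concavity is exactly the condition [g >= 2/3].
    Hence the [k]-th extremum of [F_n] grows in absolute value with [n], and
    [F_(n+1)] has one more extremum than [F_n]. *)

Require Import Defs.
From mathcomp Require Import all_boot all_order all_algebra.
From mathcomp Require Import all_classical all_reals all_analysis.
From mathcomp Require Import measurable_realfun ring lra.
Set Implicit Arguments.
Unset Strict Implicit.
Unset Printing Implicit Defensive.
Import Order.TTheory GRing.Theory Num.Theory.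
Import numFieldNormedType.Exports.
Local Open Scope classical_set_scope.
Local Open Scope ring_scope.

(** * Coefficients of the Jacobi polynomials *)

Section JacobiCoefficients.
Variable R : realType.
Implicit Types (b g : R) (n k : nat) (p q : {poly R}).

(** Comparing at equal angle pairs the extrema of the two functions, but it requires the angle to be
    strictly increasing although the damping [1 / m] blows up at both ends. The angular speed is
    therefore a quotient of polynomials, whose positivity is proved on the closed interval. The
    angle is the integral of this rate, not an arctangent, so no branch has to be chosen; its link
    with [F] and [F'] comes from a conserved quantity.

    In terms of the angle, the logarithm of the energy [l^2 F^2 + F'^2] falls at rate
    [2 sin^2 psi / (c - sin psi cos psi)], which decreases in [c], so only the order of the two
    values of [c] matters. Both start at 0 with the same slope, which defeats a direct first-contact
    argument; the smaller one is scaled by a factor [k < 1].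

    Strictness comes from the end [t = -1]: the larger [l] has turned further there, so its [F] has
    changed sign once more. *)

Lemma risingS (a : R) k : rising a k.+1 = rising a k * (a + k%:R).
Proof. by rewrite /rising big_ord_recr. Qed.

Lemma risingSl (a : R) k : rising a k.+1 = a * rising (a + 1) k.
Proof.
rewrite /rising big_ord_recl addr0; congr (_ * _).
by apply: eq_bigr => i _; rewrite /bump /= natrD addrA.
Qed.

Lemma rising_nat k m : rising (k%:R + 1 : R) m = (k + m)`!%:R / k`!%:R.
Proof.
elim: m => [|m IH].
  by rewrite /rising big_ord0 addn0 divff // pnatr_eq0 -lt0n fact_gt0.
rewrite risingS IH addnS factS natrM -(addn1 (k + m)) !natrD.
by rewrite [X in _ = X / _]mulrC mulrAC; congr (_ * _ / _); ring.
Qed.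

(** Coefficients in powers of [(t - 1) / 2]. Expanding at 1 gives consecutive coefficients an
    explicit ratio, so the differential and connection formulas can be checked coefficientwise. *)
Definition jacobi_coef b n k : R :=
  'C(n, k)%:R * rising (n%:R + b + 1) k / k`!%:R.

Lemma jacobi_coef_gt b n k : (n < k)%N -> jacobi_coef b n k = 0.
Proof. by move=> nk; rewrite /jacobi_coef bin_small // !mul0r. Qed.

Lemma jacobi_coefS b n k :
  jacobi_coef b n k.+1 * (k%:R + 1) ^+ 2 =
  jacobi_coef b n k * ((n%:R - k%:R) * (n%:R + k%:R + b + 1)).
Proof.
have [nk|kn] := ltnP n k; first by rewrite !jacobi_coef_gt ?mul0r // ltnW.
have k1 : k%:R + 1 != 0 :> R by rewrite natr1 pnatr_eq0.
have kf : k`!%:R != 0 :> R by rewrite pnatr_eq0 -lt0n fact_gt0.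
have bS : 'C(n, k.+1)%:R * (k%:R + 1) = 'C(n, k)%:R * (n%:R - k%:R) :> R.
  by rewrite natr1 -natrB // -!natrM mulnC mul_bin_left mulnC.
rewrite /jacobi_coef risingS factS natrM -natr1.
transitivity ('C(n, k.+1)%:R * (k%:R + 1) * rising (n%:R + b + 1) k
  * (n%:R + b + 1 + k%:R) / k`!%:R); first by field; rewrite kf k1.
by rewrite bS; ring.
Qed.

(** By [coef_jacobi_aux_dilate] the right-hand side is [k + 1] times a coefficient of
    [S_n - S_(n-1)], where [S_n] is the right-hand side of [sum_jacobi]; summing over the degree
    then telescopes. At [n = 0] the truncated [n.-1] is killed by the factor [n]. *)
Lemma jacobi_coef_lower b n k :
  jacobi_coef b n k * (k%:R + 1) * (2 * n%:R + b + 1) =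
  (n%:R + 1) * (n%:R + b + 1) * jacobi_coef (b + 1) n k -
  n%:R * (n%:R + b) * jacobi_coef (b + 1) n.-1 k.
Proof.
have kf : k`!%:R != 0 :> R by rewrite pnatr_eq0 -lt0n fact_gt0.
have E1 : (n%:R + b + 1) * rising (n%:R + (b + 1) + 1) k =
    rising (n%:R + b + 1) k * (n%:R + b + 1 + k%:R).
  by rewrite -risingS risingSl addrA.
case: n E1 => [|n] E1.
  rewrite mul0r mul0r subr0 mulr0 add0r !add0r mul1r.
  case: k kf E1 => [|k] kf E1; last by rewrite !jacobi_coef_gt // !mul0r mulr0.
  by rewrite /jacobi_coef /rising !big_ord0; ring.
have bn : 'C(n, k)%:R * (n%:R + 1) = 'C(n.+1, k)%:R * (n%:R + 1 - k%:R) :> R.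
  have [nk|kn] := ltnP n.+1 k; first by rewrite !bin_small ?mul0r // ltnW.
  rewrite natr1 -natrB // -!natrM; congr (_%:R).
  case: k kf E1 kn => [|k] kf E1 kn; first by rewrite !bin0 subn0.
  by rewrite mulnC mul_bin_down mulnC.
rewrite -natr1 /= in E1 *; rewrite /jacobi_coef -natr1.
have -> : n%:R + (b + 1) + 1 = n%:R + 1 + b + 1 by ring.
transitivity ('C(n.+1, k)%:R / k`!%:R * ((n%:R + 1 + 1) *
   ((n%:R + 1 + b + 1) * rising (n%:R + 1 + (b + 1) + 1) k))
  - ('C(n, k)%:R * (n%:R + 1)) * (n%:R + 1 + b) * rising (n%:R + 1 + b + 1) k
    / k`!%:R); last by ring.
by rewrite E1 bn; ring.
Qed.

Definition dilate : {poly R} := 1 + 2%:P * 'X.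

Lemma jacobi_dilate b n :
  jacobi 0 b n \Po dilate = \poly_(k < n.+1) jacobi_coef b n k.
Proof.
rewrite poly_def /jacobi raddf_sum; apply: eq_bigr => /= i _.
rewrite linearZ /= rmorphXn /= linearZ /= rmorphB /= rmorph1.
have -> : 2^-1 *: (('X \Po dilate) - 1) = 'X.
  by rewrite comp_polyX /dilate addrC addKr mul_polyC scalerA mulVf ?scale1r.
congr (_ *: _); rewrite /jacobi_coef addr0 add0r rising_nat.
have ile : (i <= n)%N by rewrite -ltnS.
have f0 m : m`!%:R != 0 :> R by rewrite pnatr_eq0 -lt0n fact_gt0.
rewrite subnKC // -(bin_fact ile) !natrM.
by field; rewrite !f0.
Qed.

Lemma coef_jacobi_dilate b n k :
  (jacobi 0 b n \Po dilate)`_k = jacobi_coef b n k.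
Proof.
rewrite jacobi_dilate coef_poly; case: ltnP => // kn.
by rewrite jacobi_coef_gt.
Qed.

Lemma dilate_inj p q : p \Po dilate = q \Po dilate -> p = q.
Proof.
have K r : (r \Po dilate) \Po (2^-1 *: ('X - 1)) = r.
  rewrite -comp_polyA /dilate rmorphD rmorphM /= rmorph1 comp_polyC comp_polyX.
  by rewrite mul_polyC scalerA mulfV // scale1r addrC subrK comp_polyXr.
by move=> E; rewrite -[p]K E K.
Qed.

Lemma deriv_dilate p : (p \Po dilate)^`() = 2%:P * (p^`() \Po dilate).
Proof.
rewrite deriv_comp /dilate derivD derivM derivX !derivC add0r mul0r add0r mulr1.
exact: mulrC.
Qed.

(* [jacobi_aux g p] is [(1 + t)^(1 - g) * d/dt ((1 + t)^g * p)]. *)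
Definition jacobi_aux g p : {poly R} := (1 + 'X) * p^`() + g%:P * p.

Lemma jacobi_aux_dilate g p : jacobi_aux g p \Po dilate =
  (1 + 'X) * (p \Po dilate)^`() + g%:P * (p \Po dilate).
Proof.
rewrite /jacobi_aux deriv_dilate rmorphD !rmorphM /= rmorphD /= rmorph1.
by rewrite comp_polyX comp_polyC /dilate; ring.
Qed.

Lemma coef_jacobi_aux_dilate b n k :
  (jacobi_aux b (jacobi 0 b n) \Po dilate)`_k * (k%:R + 1) =
  (n%:R + 1) * (n%:R + b) * jacobi_coef b n k.
Proof.
rewrite jacobi_aux_dilate [(1 + _) * _]mulrDl mul1r !coefD coefXM coefCM.
rewrite !coef_deriv !coef_jacobi_dilate.
have -> : (if k == 0 then 0 else jacobi_coef b n k.-1.+1 *+ k.-1.+1) =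
          jacobi_coef b n k * k%:R.
  by case: k => [|k] /=; rewrite ?mulr0 // mulr_natr.
have E := jacobi_coefS b n k.
rewrite -(mulr_natr (jacobi_coef b n k.+1)) -natr1.
by transitivity (jacobi_coef b n k.+1 * (k%:R + 1) ^+ 2 +
  (k%:R + b) * (k%:R + 1) * jacobi_coef b n k); [ring|rewrite E; ring].
Qed.

(** The Jacobi differential equation as a first-order relation: under [t = 1 + 2 X] the operator
    [(1 - t) d/dt] becomes [- X d/dX], which multiplies the [k]-th coefficient by [- k]. *)
Lemma jacobi_aux_deriv b n (S := jacobi_aux b (jacobi 0 b n)) :
  (1 - 'X) * S^`() = S - ((n%:R + 1) * (n%:R + b))%:P * jacobi 0 b n.
Proof.
move: (coef_jacobi_aux_dilate b n); rewrite -/S; move: ((n%:R + 1) * (n%:R + b)) => lam cS.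
apply: dilate_inj.
rewrite rmorphB !rmorphM rmorphB /= rmorph1 comp_polyX comp_polyC.
have -> : (1 - dilate) * (S^`() \Po dilate) = - ((S \Po dilate)^`() * 'X).
  by rewrite deriv_dilate /dilate; ring.
apply/polyP => k; rewrite coefN coefMX coefB coefCM coef_jacobi_dilate.
rewrite -cS coef_deriv.
by case: k => [|k] /=; [ring|rewrite -(mulr_natr (_`_k.+1)) -natr1; ring].
Qed.

(** Christoffel-Darboux at 1: by [jacobi_hE] the left-hand side is [2^(b + 1)] times the kernel. *)
Lemma sum_jacobi b n :
  \sum_(j < n.+1) (2 * j%:R + b + 1)%:P * jacobi 0 b j =
  jacobi_aux (b + 1) (jacobi 0 (b + 1) n).
Proof.
apply: dilate_inj; apply/polyP => k.
have k1 : k%:R + 1 != 0 :> R by rewrite natr1 pnatr_eq0.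
apply: (mulIf k1); rewrite coef_jacobi_aux_dilate.
rewrite raddf_sum coef_sum mulr_suml /=.
elim: n => [|n IH].
  have E := jacobi_coef_lower b 0 k.
  rewrite big_ord1 rmorphM /= comp_polyC coefCM coef_jacobi_dilate.
  transitivity (jacobi_coef b 0 k * (k%:R + 1) * (2 * 0%:R + b + 1)); first by ring.
  by rewrite E; ring.
rewrite big_ord_recr /= IH rmorphM /= comp_polyC coefCM coef_jacobi_dilate.
have := jacobi_coef_lower b n.+1 k => /=; rewrite -[n.+1%:R]natr1 => E.
set x := (X in _ + X); have -> : x = jacobi_coef b n.+1 k * (k%:R + 1) *
  (2 * (n%:R + 1) + b + 1) by rewrite /x; ring.
by rewrite E; ring.
Qed.

End JacobiCoefficients.

(** * Integration against the weight *)

Section WeightedIntegral.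
Variables (R : realType) (b : R).
Hypothesis b1 : -1 < b.
Implicit Types (p q : {poly R}) (s t c d : R).
Local Notation mu := lebesgue_measure.

Global Instance is_derive_horner p t : is_derive t 1 (horner p) p^`().[t].
Proof.
split; first exact: derivable_horner.
by rewrite -derive1E -derivE.
Qed.

Definition wpoly q t := (1 + t) `^ (b + 1) * q.[t].

Let b1p : 0 < b + 1. Proof. by rewrite -ltrBlDr sub0r. Qed.

Lemma is_derive_wpoly q t : -1 < t ->
  is_derive t 1 (wpoly q) ((jacobi_aux (b + 1) q).[t] * (1 + t) `^ b).
Proof.
move=> t1; have t0 : 0 < 1 + t by lra.
have D1 : is_derive t 1 (fun s => (1 + s) `^ (b + 1)) ((b + 1) * (1 + t) `^ b).
  have -> : (b + 1) * (1 + t) `^ b = ((b + 1) * (1 + t) `^ (b + 1 - 1)) * (0 + 1).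
    by rewrite addrK add0r mulr1.
  apply: (@is_derive1_comp R (fun x => x `^ (b + 1)) (fun s => 1 + s)).
  exact: is_derive1_powR.
have D := is_deriveM D1 (is_derive_horner q t).
apply: is_derive_eq; rewrite /jacobi_aux !hornerE /GRing.scale /=.
rewrite powRD; last by rewrite (gt_eqF t0) implybT.
by rewrite powRr1 ?ltW //; ring.
Qed.

Lemma wpolyN1 q : wpoly q (-1) = 0.
Proof. by rewrite /wpoly subrr powR0 ?mul0r // gt_eqF. Qed.

Lemma wpoly_cvg_right q t : -1 <= t -> wpoly q x @[x --> t^'+] --> wpoly q t.
Proof.
rewrite le_eqVlt => /predU1P[<-|t1].
  rewrite wpolyN1 -(mul0r q.[-1]); apply: cvgM.
    apply/cvg_at_rightP => u [u1 uN].
    have /cvg_at_rightP := powR_cvg0 b1p.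
    apply; split=> [n|]; first by have := u1 n; lra.
    have -> : 0 = 1 + (-1) :> R by rewrite subrr.
    by apply: cvgD => //; exact: cvg_cst.
  apply: cvg_at_right_filter; exact: continuous_horner.
apply: cvg_at_right_filter.
apply/differentiable_continuous/derivable1_diffP.
by have [] := is_derive_wpoly q t1.
Qed.

Lemma wpoly_continuous q c d : -1 <= c -> {within `[c, d], continuous (wpoly q)}.
Proof.
move=> c1; have [cd|cd|<-] := ltgtP c d.
- apply/(continuous_within_itvP _ cd); split; last 2 first.
  + exact: wpoly_cvg_right.
  + apply: cvg_at_left_filter.
    apply/differentiable_continuous/derivable1_diffP.
    by have [] := is_derive_wpoly q (le_lt_trans c1 cd).
  move=> t; rewrite in_itv /= => /andP[ct _].
  apply/differentiable_continuous/derivable1_diffP.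
  by have [] := is_derive_wpoly q (le_lt_trans c1 ct).
- by rewrite set_itv_ge ?bnd_simp -?ltNge //; exact: continuous_subspace0.
- by rewrite set_itv1; exact: continuous_subspace1.
Qed.

Lemma weight_continuous p c d : -1 < c ->
  {within `[c, d], continuous (fun t => p.[t] * (1 + t) `^ b)}.
Proof.
move=> c1; apply: derivable_within_continuous => t.
rewrite in_itv /= => /andP[ct _].
have t0 : 0 < 1 + t by lra.
apply: derivableM; first exact: derivable_horner.
have [] : is_derive t 1 (fun s => (1 + s) `^ b) (b * (1 + t) `^ (b - 1) * (0 + 1)) => //.
apply: (@is_derive1_comp R (fun x => x `^ b) (fun s => 1 + s)).
exact: is_derive1_powR.
Qed.

Lemma integral_weight_gt p q c d : -1 < c -> c < d ->
  p = jacobi_aux (b + 1) q ->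
  (\int[mu]_(t in `[c, d]) (p.[t] * (1 + t) `^ b)%:E
   = (wpoly q d)%:E - (wpoly q c)%:E)%E.
Proof.
move=> c1 cd ->; apply: continuous_FTC2 => //.
- exact: weight_continuous.
- have /(continuous_within_itvP _ cd)[_ ? ?] := @wpoly_continuous q c d (ltW c1).
  split=> // t; rewrite in_itv /= => /andP[ct _].
  by have [] := is_derive_wpoly q (lt_trans c1 ct).
- move=> t; rewrite in_itv /= => /andP[ct _].
  by rewrite derive1E; have [_ ->] := is_derive_wpoly q (lt_trans c1 ct).
Qed.

Lemma measurable_weight p (A : set R) :
  measurable_fun A (fun t => p.[t] * (1 + t) `^ b).
Proof.
apply: measurable_funTS; apply: measurable_funM => /=.
  by apply: continuous_measurable_fun; exact: continuous_horner.
apply: (measurableT_comp (measurable_powR b)) => //.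
by apply: measurable_funD => //; exact: measurable_cst.
Qed.

(** For [b < 0] the weight is unbounded near -1. The antiderivative [(1 + t)^(b + 1) / (b + 1)]
    bounds its integrals over intervals exhausting []-1, 1]], and monotone convergence concludes. *)
Lemma integrable_weight1 : mu.-integrable `[-1, 1] (fun t => ((1 + t) `^ b)%:E).
Proof.
pose e n : R := n.+1%:R^-1 : R.
have e0 n : 0 < e n by rewrite /e invr_gt0.
pose A n : set R := `[-1 + e n, 1]%classic.
have UA : \bigcup_n A n = `]-1, 1]%classic.
  apply/seteqP; split=> [t [n _]|t]; rewrite /A /= !in_itv /= => /andP[t1 t2].
    by apply/andP; split => //; have := e0 n; lra.
  have t0 : 0 < t + 1 by lra.
  have [n nt] : exists n : nat, e n < t + 1.
    by have [N _ HN] := near_infty_natSinv_lt (PosNum t0); exists N; apply: HN => /=.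
  exists n => //=; rewrite in_itv /= t2 andbT; lra.
have mw (B : set R) : measurable_fun B (fun t => ((1 + t) `^ b)%:E).
  apply/measurable_EFinP; have := @measurable_weight 1 B.
  by apply: eq_measurable_fun => t _; rewrite hornerC mul1r.
have ndA : nondecreasing_seq A.
  apply/nondecreasing_seqP => n; rewrite subsetEset; apply: subset_itvr.
  rewrite bnd_simp lerD2l /e lef_pV2 ?posrE ?ler_nat //; exact: ltr0n.
have A0 n t : A n t -> (0 <= ((1 + t) `^ b)%:E)%E.
  by move=> _; rewrite lee_fin powR_ge0.
have mA n : measurable (A n) by exact: measurable_itv.
have bound n : (\int[mu]_(t in A n) ((1 + t) `^ b)%:E <=
    (wpoly (b + 1)^-1%:P 1)%:E)%E.
  have [en|en] := leP 1 (-1 + e n).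
    rewrite /A; have [->|ne] := eqVneq (-1 + e n) 1.
      by rewrite set_itv1 integral_set1 lee_fin mulr_ge0 ?powR_ge0 ?hornerC ?invr_ge0 ?ltW.
    rewrite set_itv_ge ?bnd_simp -?ltNge ?lt_neqAle ?en 1?eq_sym ?ne // integral_set0.
    by rewrite lee_fin mulr_ge0 ?powR_ge0 ?hornerC ?invr_ge0 ?ltW.
  have E : 1 = jacobi_aux (b + 1) (b + 1)^-1%:P.
    by rewrite /jacobi_aux derivC mulr0 add0r -polyCM mulfV ?gt_eqF.
  have en1 : -1 < -1 + e n by have := e0 n; lra.
  have := integral_weight_gt en1 en E.
  under eq_integral do rewrite hornerC mul1r.
  move=> ->; rewrite -EFinB lee_fin gerBl mulr_ge0 ?powR_ge0 ?hornerC ?invr_ge0 ?ltW //.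
have fin : (\int[mu]_(t in `[(-1)%R, 1%R]) ((1 + t)%R `^ b)%R%:E < +oo)%E.
  rewrite -integral_itv_obnd_cbnd // -UA.
  have cvA : (\int[mu]_(t in A n) ((1 + t) `^ b)%:E @[n --> \oo] -->
      \int[mu]_(t in \bigcup_n A n) ((1 + t) `^ b)%:E)%E.
    by apply: ge0_nondecreasing_set_cvg_integral => // n; exact: mw.
  rewrite -(cvg_lim _ cvA) //.
  apply: (@le_lt_trans _ _ (wpoly (b + 1)^-1%:P (1 : R)%R)%:E); last exact: ltry.
  by apply: lime_le; [exact: cvgP cvA|exact: nearW].
apply/integrableP; split; first exact: mw.
by under eq_integral do rewrite gee0_abs ?lee_fin ?powR_ge0 //.
Qed.

Lemma integrable_weight p c d : -1 <= c -> d <= 1 ->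
  mu.-integrable `[c, d] (fun t => (p.[t] * (1 + t) `^ b)%:E).
Proof.
move=> c1 d1; apply: (@integrableS _ _ R mu `[-1, 1]%classic) => //.
  by apply: subset_itv; rewrite bnd_simp.
have := @integrableMr _ _ R mu `[-1, 1]%classic _ (horner p) (fun t => ((1 + t) `^ b)%:E).
apply => //; last exact: integrable_weight1.
  by apply: measurable_funTS; apply: continuous_measurable_fun; exact: continuous_horner.
have /compact_bounded[M [Mr HM]] : compact (horner p @` `[-1, 1]).
  apply: continuous_compact; last exact: segment_compact.
  by apply: continuous_subspaceT; exact: continuous_horner.
by exists M; split=> // x Mx y /= y1; apply: HM => //; exists y.
Qed.

Lemma Rintegral_weight p q c d : -1 <= c -> c <= d -> d <= 1 ->
  p = jacobi_aux (b + 1) q ->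
  \int[mu]_(t in `[c, d]) (p.[t] * (1 + t) `^ b) = wpoly q d - wpoly q c.
Proof.
move=> c1 cd d1 pq.
have [cd'|dc] := ltrP c d; last first.
  have -> : c = d by apply/eqP; rewrite eq_le cd dc.
  by rewrite set_itv1 Rintegral_set1 subrr.
have [c1'|] := ltrP (-1) c.
  by rewrite /Rintegral (integral_weight_gt c1' cd' pq).
(* At -1 the weight may be singular, so the fundamental theorem is applied on [[x, d]] only:
   [G - wpoly q] is constant to the right of -1 and tends to 0 there. *)
move=> c1'; have cN : c = -1 by apply/eqP; rewrite eq_le c1 c1'.
rewrite {c cd c1 c1'}cN in cd' *.
have fi : mu.-integrable `[-1, d] (EFin \o (fun t => p.[t] * (1 + t) `^ b)).
  exact: integrable_weight.
pose G x := \int[mu]_(t in `[-1, x]) (p.[t] * (1 + t) `^ b).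
have G1 : G (-1) = 0 by rewrite /G set_itv1 Rintegral_set1.
have lim0 : G x - wpoly q x @[x --> (-1)^'+] --> 0.
  rewrite -[X in _ --> X](subrr 0) -[X in X - _]G1 -[X in _ - X](wpolyN1 q).
  apply: cvgB; last exact: wpoly_cvg_right.
  by have /(continuous_within_itvP _ cd')[_ + _] :=
    parameterized_integral_continuous (ltW cd') fi.
have limc : G x - wpoly q x @[x --> (-1)^'+] --> G d - wpoly q d.
  apply: cvg_near_cst; near=> x.
  have x1 : -1 < x by near: x; exact: nbhs_right_gt.
  have xd : x < d by near: x; exact: nbhs_right_lt.
  suff : G d - G x = wpoly q d - wpoly q x by move=> E; lra.
  rewrite /G Rintegral_itvB ?bnd_simp ?ltW //.
  rewrite Rintegral_itv_obnd_cbnd; last first.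
    apply: (integrableS _ _ _ fi) => //.
    by apply: subset_itvr; rewrite bnd_simp ltW.
  by rewrite /Rintegral (integral_weight_gt x1 xd pq).
rewrite -/(G d) wpolyN1 subr0.
by apply/eqP; rewrite -subr_eq0; apply/eqP; apply: cvg_unique limc lim0.
Unshelve. all: by end_near.
Qed.

End WeightedIntegral.

(** * Orthogonality and the kernel *)

Section Orthogonality.
Variables (R : realType) (b : R).
Hypothesis b1 : -1 < b.
Implicit Types (p q : {poly R}) (j k n : nat).
Local Notation mu := lebesgue_measure.

Let b1p : 0 < b + 1. Proof. by rewrite -ltrBlDr sub0r. Qed.

Definition wint p := \int[mu]_(t in `[-1, 1]) (p.[t] * (1 + t) `^ b).

Lemma wintD p q : wint (p + q) = wint p + wint q.
Proof.
rewrite /wint -RintegralD //; try exact: integrable_weight.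
by apply: eq_Rintegral => t _; rewrite hornerD mulrDl.
Qed.

Lemma wintZ c p : wint (c%:P * p) = c * wint p.
Proof.
rewrite /wint -RintegralZl //; last exact: integrable_weight.
by apply: eq_Rintegral => t _; rewrite hornerM hornerC mulrA.
Qed.

Lemma wint0 : wint 0 = 0.
Proof. by rewrite -[0 in LHS](mul0r 0) wintZ mul0r. Qed.

Lemma wint_aux q : wint (jacobi_aux (b + 1) q) = 2 `^ (b + 1) * q.[1].
Proof.
rewrite /wint (@Rintegral_weight _ _ b1 _ q) ?lexx ?ge0_cp //.
by rewrite wpolyN1 // subr0 /wpoly.
Qed.

Lemma deriv_expX1 k :
  (1 + 'X) * ((1 + 'X) ^+ k)^`() = k%:R%:P * (1 + 'X) ^+ k :> {poly R}.
Proof.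
case: k => [|k]; first by rewrite derivC mulr0 polyC0 mul0r.
rewrite deriv_exp derivD derivC derivX add0r mul1r /= -mulr_natl -polyC_natr.
by rewrite exprS mulrCA.
Qed.

Let SJ j := jacobi_aux_deriv b j.

(** Self-adjointness of the Jacobi operator: the two sides differ by the integral of the derivative
    of [(1 + t)^(b + 1) (1 - t) (P' q - P q')], which vanishes at both ends. *)
Lemma wint_sturm j q :
  wint (jacobi 0 b j *
    ((1 - 'X) * jacobi_aux (b + 1) q^`() - (1 + 'X) * q^`())) =
  - (j%:R * (j%:R + b + 1)) * wint (jacobi 0 b j * q).
Proof.
set P := jacobi 0 b j.
have E : jacobi_aux (b + 1) ((1 - 'X) * (P^`() * q - P * q^`())) =
  - ((j%:R * (j%:R + b + 1))%:P * (P * q) +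
  P * ((1 - 'X) * jacobi_aux (b + 1) q^`() - (1 + 'X) * q^`())).
  have := SJ j; rewrite -/P /jacobi_aux.
  rewrite !(derivD, derivM, derivN, derivC, derivX) => EP.
  have {EP} EP : (1 - 'X) * ((1 + 'X) * P^`()^`() + (b + 1)%:P * P^`()) =
     (1 + 'X) * P^`() - (j%:R * (j%:R + b + 1))%:P * P.
    transitivity ((1 - 'X) * ((0 + 1) * P^`() + (1 + 'X) * P^`()^`() +
      (0 * P + b%:P * P^`()))); first by rewrite polyCD polyC1; ring.
    by rewrite EP !(polyCD, polyCM, polyC1); ring.
  transitivity (q * ((1 - 'X) * ((1 + 'X) * P^`()^`() + (b + 1)%:P * P^`()))
    - q * ((1 + 'X) * P^`())
    - P * ((1 - 'X) * ((1 + 'X) * q^`()^`() + (b + 1)%:P * q^`())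
           - (1 + 'X) * q^`())); first by ring.
  by rewrite EP; ring.
have := wint_aux ((1 - 'X) * (P^`() * q - P * q^`())).
have -> : ((1 - 'X) * (P^`() * q - P * q^`())).[1] = 0.
  by rewrite hornerM hornerD hornerN hornerX hornerC subrr mul0r.
have N1 : -1 = (-1)%:P :> {poly R} by rewrite polyCN.
by rewrite E mulr0 -mulN1r N1 wintZ wintD wintZ; lra.
Qed.

(** On powers of [1 + t] the operator of [wint_sturm] is triangular with diagonal entries
    [- k (k + b + 1)]. For [k < j] these differ from the eigenvalue of [jacobi 0 b j], which forces
    the integral to vanish by induction. *)
Lemma wint_jacobi_exp j k : (k < j)%N ->
  wint (jacobi 0 b j * (1 + 'X) ^+ k) = 0.
Proof.
elim: k => [|k IH] kj.
  have := wint_sturm j 1; rewrite derivC /jacobi_aux derivC !mulr0 addr0 !mulr0.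
  rewrite subrr mulr0 wint0 expr0 => /esym/eqP; rewrite mulf_eq0 oppr_eq0 => /orP[|/eqP //].
  by rewrite mulf_eq0 pnatr_eq0 -[j == 0%N]negbK -lt0n kj /= gt_eqF // -addrA ltr_wpDl.
have {IH} IH := IH (ltnW kj).
have := wint_sturm j ((1 + 'X) ^+ k.+1).
set u := 1 + 'X; have -> : (u ^+ k.+1)^`() = k.+1%:R%:P * u ^+ k.
  by rewrite deriv_exp /u derivD derivC derivX add0r mul1r /= -mulr_natl -polyC_natr.
have -> : jacobi_aux (b + 1) (k.+1%:R%:P * u ^+ k) =
   (k.+1%:R * (k%:R + b + 1))%:P * u ^+ k.
  rewrite /jacobi_aux derivM derivC mul0r add0r mulrCA deriv_expX1 -/u.
  by rewrite !(polyCD, polyCM, polyC1); ring.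
have -> : jacobi 0 b j * ((1 - 'X) * ((k.+1%:R * (k%:R + b + 1))%:P * u ^+ k) -
     u * (k.+1%:R%:P * u ^+ k)) =
   (2 * k.+1%:R * (k%:R + b + 1))%:P * (jacobi 0 b j * u ^+ k) +
   (- (k.+1%:R * (k.+1%:R + b + 1)))%:P * (jacobi 0 b j * u ^+ k.+1).
  have -> : 1 - 'X = 2%:P - u by rewrite /u -[2]/(1 + 1) polyCD polyC1; ring.
  by rewrite exprS -[k.+1%:R]natr1 !(polyCN, polyCD, polyCM, polyC1); ring.
rewrite wintD !wintZ IH mulr0 add0r => /eqP; rewrite -subr_eq0 -mulrBl mulf_eq0.
case/orP => [|/eqP //]; rewrite opprK addrC subr_eq0 => /eqP E; exfalso.
have jk : k.+1%:R < j%:R :> R by rewrite ltr_nat.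
have k0 : 0 <= k.+1%:R :> R by [].
suff : k.+1%:R * (k.+1%:R + b + 1) < j%:R * (j%:R + b + 1) by rewrite E ltxx.
move: k0 jk; move: (k.+1%:R) (j%:R) => x y x0 xy; rewrite -subr_gt0.
have -> : y * (y + b + 1) - x * (x + b + 1) = (y - x) * (y + x + (b + 1)) by ring.
apply: mulr_gt0; first by rewrite subr_gt0.
by rewrite ltr_wpDl // addr_ge0 // (le_trans x0) ?ltW.
Qed.

Lemma wint_jacobi_lower j q : (size q <= j)%N -> wint (jacobi 0 b j * q) = 0.
Proof.
move=> qj; have -> : q = (q \Po ('X - 1)) \Po (1 + 'X).
  by rewrite -comp_polyA rmorphB /= rmorph1 comp_polyX addrAC subrr add0r comp_polyXr.
set r := q \Po _; have rj : (size r <= j)%N.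
  by rewrite /r -polyC1 size_comp_poly2 // size_XsubC.
rewrite comp_polyE mulr_sumr (big_morph wint wintD wint0) big1 // => i _.
rewrite -mul_polyC mulrCA wintZ wint_jacobi_exp ?mulr0 //.
exact: leq_trans (ltn_ord i) rj.
Qed.

Lemma size_jacobi j : (size (jacobi 0 b j) <= j.+1)%N.
Proof.
rewrite /jacobi; apply: (leq_trans (size_sum _ _ _)); apply/bigmax_leqP => i _.
apply: (leq_trans (size_scale_leq _ _)); apply: (leq_trans (size_poly_exp_leq _ _)).
have ij : (i <= j)%N by rewrite -ltnS.
rewrite ltnS (leq_trans _ ij) // -{2}[nat_of_ord i]mul1n leq_mul2r.
apply/orP; right; rewrite -polyC1; have := size_scale_leq 2^-1 ('X - 1%:P : {poly R}).
by rewrite size_XsubC; case: (size _) => [|[|[]]].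
Qed.

Lemma jacobi0_at1 g j : (jacobi 0 g j).[1] = 1 :> R.
Proof.
by rewrite jacobi_at1 -[0](mulr0n 1) rising_nat add0n fact0 divr1 divff
  // pnatr_eq0 -lt0n fact_gt0.
Qed.

(** Integrating the derivative of [(1 + t)^(b + 1) P^2] leaves a boundary value at 1. The remainder
    [(1 + t) P' - j P] has lost its leading term, hence is orthogonal to [P]. *)
Lemma jacobi_hE j : jacobi_h b j * (2 * j%:R + b + 1) = 2 `^ (b + 1).
Proof.
have -> : jacobi_h b j = wint (jacobi 0 b j * jacobi 0 b j).
  by apply: eq_Rintegral => t _; rewrite hornerM expr2.
set P := jacobi 0 b j.
have E : jacobi_aux (b + 1) (P * P) = (2 * j%:R + b + 1)%:P * (P * P) +
   2%:P * (P * ((1 + 'X) * P^`() - j%:R%:P * P)).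
  by rewrite /jacobi_aux derivM -[2]/(1 + 1) !(polyCD, polyCM, polyC1); ring.
have := wint_aux (P * P); rewrite hornerM jacobi0_at1 !mulr1 => <-.
rewrite E wintD !wintZ (@wint_jacobi_lower j (_ - _)); first by rewrite mulr0 addr0 mulrC.
apply/leq_sizeP => i ji.
rewrite coefB mulrDl mul1r coefD coefXM coefCM !coef_deriv.
have Pi m : (j < m)%N -> P`_m = 0.
  by move=> jm; apply: nth_default; exact: leq_trans (size_jacobi j) jm.
rewrite Pi ?ltnS // mul0rn add0r.
have [ij|ij] := eqVneq i j.
  by rewrite ij; case: (j) => [|m] /=; rewrite ?mul0r ?subrr // mulr_natl subrr.
have ji' : (j < i)%N by rewrite ltn_neqAle eq_sym ij.
rewrite (Pi i) // mulr0 subr0; case: i ji' {ji ij} => //= i ji.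
by rewrite Pi ?mul0rn // ltnW.
Qed.

Lemma ellE n (S := jacobi_aux (b + 1) (jacobi 0 (b + 1) n)) :
  ell b n = (2 `^ (b + 1))^-1 * \int[mu]_(t in `[-1, 1]) (`|S.[t]| * (1 + t) `^ b).
Proof.
have p0 : 0 < 2 `^ (b + 1) by exact: powR_gt0.
have pj j : 0 < 2 * j%:R + b + 1 by rewrite -addrA ltr_wpDl ?mulr_ge0.
rewrite /ell /jacobi_lebesgue_fun.
have K t : jacobi_kernel b n 1 t = (2 `^ (b + 1))^-1 * S.[t].
  rewrite /jacobi_kernel /S -sum_jacobi horner_sum mulr_sumr.
  apply: eq_bigr => j _; rewrite jacobi0_at1 mul1r hornerM hornerC.
  have -> : jacobi_h b j = 2 `^ (b + 1) / (2 * j%:R + b + 1).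
    by rewrite -(jacobi_hE j) mulfK // gt_eqF.
  by rewrite invf_div; ring.
rewrite -RintegralZl //.
  by apply: eq_Rintegral => t _; rewrite K normrM ger0_norm ?mulrA // invr_ge0 ltW.
have := integrable_norm (integrable_weight b1 S (lexx (-1)) (lexx 1)).
apply: eq_integrable => // t _.
by rewrite /= normrM (ger0_norm (powR_ge0 _ _)).
Qed.

End Orthogonality.

(** * Real analysis *)

Section Calculus.
Variable R : realType.
Implicit Types (f d : R -> R) (x y a b c : R).
Local Notation mu := lebesgue_measure.

Lemma is_derive_continuous f x l : is_derive x 1 f l -> {for x, continuous f}.
Proof.
by move=> [fx _]; exact/differentiable_continuous/derivable1_diffP.
Qed.

Lemma continuous_gt0 f x : {for x, continuous f} -> 0 < f x ->
  exists2 e, 0 < e & forall y, `|y - x| < e -> 0 < f y.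
Proof.
move=> fx fx0; have : \forall y \near x, 0 < f y by exact: (@cvgr_gt _ _ _ _ _ (f x) fx).
move=> /nbhs_ballP[e e0 He].
by exists e => // y yx; apply: He; rewrite /ball /= distrC.
Qed.

Lemma sign_near d x l : is_derive x 1 d l -> (d x = 0 -> 0 < l) ->
  exists2 e, 0 < e & forall y, `|y - x| < e ->
    (0 <= d x -> x < y -> 0 < d y) /\ (d x <= 0 -> y < x -> d y < 0).
Proof.
move=> dx dx0; have [d0|d0|d0] := ltgtP (d x) 0.
- have cN : {for x, continuous (fun y => - d y)}.
    by apply: continuousN; exact: is_derive_continuous dx.
  have [|e e0 He] := continuous_gt0 cN; first by rewrite oppr_gt0.
  by exists e => // y /He; rewrite oppr_gt0 => dy; split.
- have [e e0 He] := continuous_gt0 (is_derive_continuous dx) d0.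
  by exists e => // y /He dy; split.
have /is_derive1_caratheodory[h [hE hC hx]] := dx.
have [|e e0 He] := continuous_gt0 hC; first by rewrite hx dx0.
exists e => // y /He hy; have := hE y; rewrite d0 subr0 => ->; split => _ xy.
  by rewrite mulr_gt0 // subr_gt0.
by rewrite nmulr_llt0 ?subr_lt0.
Qed.

(** Let [s] be the supremum of the initial stretch where [d] is positive: if [d s] were nonpositive
    with [a < s], then [d] would be negative just before [s]. The derivative condition at [a] itself
    is what starts the stretch. *)
Lemma contact d dd a b :
  (forall x, a <= x <= b -> is_derive x 1 d (dd x)) -> d a = 0 ->
  (forall x, a <= x <= b -> d x = 0 -> 0 < dd x) ->
  forall x, a < x <= b -> 0 < d x.
Proof.
move=> Dd da up c /andP[ac cb]; rewrite ltNge; apply/negP => dc.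
pose A : set R := [set x | a <= x <= c /\ forall y, a < y <= x -> 0 < d y].
have Aa : A a.
  by split; [rewrite lexx ltW|move=> y /andP[/lt_le_trans H /H]; rewrite ltxx].
have Ac : ubound A c by move=> x [/andP[]].
have supA : has_sup A by split; [exists a|exists c].
pose s := sup A.
have sc : s <= c by apply: ge_sup => //; exists a.
have as_ : a <= s by apply: ub_le_sup => //; exists c.
have ltS y : a < y < s -> 0 < d y.
  move=> /andP[ay ys]; have [|x Ax0] := @sup_adherent _ A (s - y) _ supA.
    by rewrite subr_gt0.
  move: Ax0 => [_ Ax]; rewrite -/s subKr => yx.
  by apply: Ax; rewrite ay ltW.
have sab : a <= s <= b by rewrite as_ (le_trans sc).
have [e e0 He] := sign_near (Dd _ sab) (up _ sab).
have ds : a < s -> 0 < d s.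
  move=> as'; rewrite ltNge; apply/negP => ds.
  pose m := Num.max (s - e / 2) ((a + s) / 2).
  have ms : m < s by rewrite gt_max; apply/andP; split; lra.
  have am : a < m by rewrite lt_max; apply/orP; right; lra.
  have me : s - e / 2 <= m by rewrite le_max lexx.
  have : 0 < d m by apply: ltS; rewrite am ms.
  have [|_ H] := He m; first by rewrite distrC ger0_norm; lra.
  by rewrite ltNge ltW // H.
have ds0 : 0 <= d s.
  by move: as_; rewrite le_eqVlt => /predU1P[<-|/ds/ltW //]; rewrite da.
have sc' : s < c.
  rewrite lt_neqAle sc andbT; apply/eqP => E.
  by have := ds; rewrite E => /(_ ac); rewrite ltNge dc.
pose m := Num.min (s + e / 2) c.
have sm : s < m by rewrite lt_min sc' andbT; lra.
have Am : A m.
  split; first by rewrite (le_trans as_ (ltW sm)) ge_min lexx orbT.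
  move=> y /andP[ay ym]; have [ys|sy|E] := ltgtP y s.
  - by apply: ltS; rewrite ay.
  - have [|H _] := He y; last exact: H.
    have : m <= s + e / 2 by rewrite ge_min lexx.
    by rewrite ger0_norm; lra.
  - by rewrite E; apply: ds; rewrite -E.
have : m <= s by apply: ub_le_sup => //; exists c.
by rewrite leNgt sm.
Qed.

(** Integrating from [a < 0] and subtracting the value at 0 makes the derivative two-sided at 0. *)
Lemma antiderivative f a b : a < 0 -> continuous f ->
  exists2 F : R -> R, F 0 = 0 & forall x, a < x < b -> is_derive x 1 F (f x).
Proof.
move=> a0 cf.
pose G x := \int[mu]_(t in `[a, x]) f t.
exists (fun x => G x - G 0) => [|x /andP[ax xb]]; first exact: subrr.
have fi : mu.-integrable `[a, b] (EFin \o f).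
  apply: continuous_compact_integrable; first exact: segment_compact.
  by apply: continuous_subspaceT => y; exact: cf.
have [dG Gf] := @continuous_FTC1 R f (BLeft a) x b xb fi ax (cf x).
have DG : is_derive x 1 G (f x) by split; [exact: dG|rewrite -derive1E; exact: Gf].
have := is_deriveB DG (is_derive_cst (G 0) x 1).
by rewrite subr0.
Qed.

End Calculus.

(** * The first-order system *)

Section SturmPair.
Variable R : realType.
Implicit Types (g l t x : R) (Q S : {poly R}).

(* With [F := (1 + t)^g * Q], these are the first-order equations
   [F' = (1 + t)^(g - 1) * S] and
   [((1 - t) * S)' = - l^2 * Q]. *)
Definition sturm_pair g l Q S :=
  [/\ 0 < l, Q.[1] = 1, S = jacobi_aux g Q &
      (1 - 'X) * S^`() = S - (l ^+ 2)%:P * Q].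

(* [damp g] at [cos theta] is [sin theta / m], and [damp_deriv g / damp g ^ 2] is
   the derivative of [m] in [theta], for the [m] of the file header. *)
Definition damp g : {poly R} := g%:P + (1 - g)%:P * 'X.
Definition damp_deriv g : {poly R} := g%:P * 'X + (1 - g)%:P.

(** [(1 + t)^(2 g - 1) * amp] is the energy [l^2 F^2 + (dF/dtheta)^2], and [l * speed / amp] is the
    derivative of the Pruefer angle in [theta]. Dividing out the power of [1 + t] leaves polynomials
    that remain meaningful at both ends. *)
Definition amp l Q S : {poly R} :=
  (l ^+ 2)%:P * (1 + 'X) * (Q * Q) + (1 - 'X) * (S * S).
Definition speed g l Q S : {poly R} := amp l Q S - damp g * Q * S.

Variables (g l : R) (Q S : {poly R}).
Hypotheses (g2 : 2^-1 < g) (QS : sturm_pair g l Q S).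

Let l0 : 0 < l. Proof. by case: QS. Qed.
Let Q1 : Q.[1] = 1. Proof. by case: QS. Qed.
Let dQ : (1 + 'X) * Q^`() = S - g%:P * Q.
Proof. by case: QS => _ _ -> _; rewrite /jacobi_aux addrK. Qed.
Let dS : (1 - 'X) * S^`() = S - (l ^+ 2)%:P * Q.
Proof. by case: QS. Qed.

Let dQt t : (1 + t) * Q^`().[t] = S.[t] - g * Q.[t].
Proof. by have /(congr1 (horner^~ t)) := dQ; rewrite !hornerE. Qed.
Let dSt t : (1 - t) * S^`().[t] = S.[t] - l ^+ 2 * Q.[t].
Proof. by have /(congr1 (horner^~ t)) := dS; rewrite !hornerE. Qed.

Lemma sturm_pair_S1 : S.[1] = l ^+ 2.
Proof. by have := dSt 1; rewrite subrr mul0r Q1 mulr1 => /eqP; rewrite eq_sym subr_eq0 => /eqP. Qed.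

Lemma sturm_pair_SN1 : S.[-1] = g * Q.[-1].
Proof. by have := dQt (-1); rewrite subrr mul0r => /eqP; rewrite eq_sym subr_eq0 => /eqP. Qed.

(* All Taylor coefficients at a common zero would vanish. *)
Lemma sturm_pair_coprime t : -1 <= t <= 1 -> Q.[t] = 0 -> S.[t] = 0 -> False.
Proof.
move=> /andP[t1 t2] Qt St.
pose u : {poly R} := 'X + t%:P.
pose q := Q \Po u; pose s := S \Po u.
have du p : (p \Po u)^`() = p^`() \Po u.
  by rewrite deriv_comp /u derivD derivX derivC addr0 mulr1.
have Eq : ((1 + t)%:P + 'X) * q^`() = s - g%:P * q.
  rewrite /q /s du.
  have := congr1 (fun p => p \Po u) dQ.
  rewrite rmorphM rmorphD rmorphB rmorphM /= rmorph1 comp_polyX comp_polyC => <-.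
  by rewrite /u polyCD polyC1; congr (_ * _); ring.
have Es : ((1 - t)%:P - 'X) * s^`() = s - (l ^+ 2)%:P * q.
  rewrite /q /s du; move: (l ^+ 2) dS => L dS'.
  have := congr1 (fun p => p \Po u) dS'.
  rewrite rmorphM !rmorphB rmorphM /= rmorph1 comp_polyX comp_polyC => <-.
  by rewrite /u; congr (_ * _); ring.
have cq k : (1 + t) * (q`_k.+1 *+ k.+1) + q`_k *+ k = s`_k - g * q`_k.
  have := congr1 (fun p : {poly R} => p`_k) Eq.
  rewrite mulrDl !coefD coefN !coefCM coefXM !coef_deriv => <-.
  by case: k => //=.
have cs k : (1 - t) * (s`_k.+1 *+ k.+1) - s`_k *+ k = s`_k - l ^+ 2 * q`_k.
  have := congr1 (fun p : {poly R} => p`_k) Es.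
  rewrite mulrBl !coefB !coefCM coefXM !coef_deriv => <-.
  by case: k => //=.
have t2' : 0 < 1 - t.
  rewrite subr_gt0 lt_neqAle t2 andbT; apply/eqP => tE.
  by move: Qt; rewrite tE Q1 => /eqP; rewrite oner_eq0.
have z k : q`_k = 0 /\ s`_k = 0.
  elim: k => [|k [qk sk]].
    by rewrite -!horner_coef0 /q /s !horner_comp /u !hornerE.
  have sk1 : s`_k.+1 = 0.
    have := cs k; rewrite qk sk mul0rn mulr0 !subr0 => /eqP.
    by rewrite mulf_eq0 gt_eqF //= mulrn_eq0 /= => /eqP.
  split => //; have [tN|tN] := eqVneq (1 + t) 0.
    have := cq k.+1; rewrite tN mul0r add0r sk1 sub0r -mulr_natl => /eqP.
    rewrite -subr_eq0 opprK -mulrDl mulf_eq0 => /orP[|/eqP //].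
    by rewrite gt_eqF // ltr_wpDl // (lt_trans _ g2).
  have := cq k; rewrite qk sk mul0rn mulr0 subr0 addr0 => /eqP.
  by rewrite mulf_eq0 (negbTE tN) /= mulrn_eq0 /= => /eqP.
have q0 : q = 0 by apply/polyP => k; rewrite coef0; case: (z k).
have : q.[1 - t] = 1 by rewrite /q horner_comp /u !hornerE subrK.
by rewrite q0 horner0 => /eqP; rewrite eq_sym oner_eq0.
Qed.

Lemma amp_gt0 t : -1 <= t <= 1 -> 0 < (amp l Q S).[t].
Proof.
move=> /[dup] t12 /andP[t1 t2].
have -> : (amp l Q S).[t] =
    l ^+ 2 * (1 + t) * (Q.[t] * Q.[t]) + (1 - t) * (S.[t] * S.[t]).
  by rewrite /amp !hornerE; ring.
have l2 : 0 < l ^+ 2 by rewrite exprn_gt0.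
have a1 : 0 <= l ^+ 2 * (1 + t) * (Q.[t] * Q.[t]).
  by rewrite -expr2 mulr_ge0 ?sqr_ge0 // mulr_ge0 ?(ltW l2) //; lra.
have a2 : 0 <= (1 - t) * (S.[t] * S.[t]).
  by rewrite -expr2 mulr_ge0 ?sqr_ge0 ?subr_ge0.
rewrite lt_def addr_ge0 // andbT paddr_eq0 //; apply/negP.
rewrite !mulf_eq0 !orbb gt_eqF //= => /andP[/orP[/eqP tN|/eqP Qt] /orP[/eqP tP|/eqP St]].
- lra.
- have tE : t = -1 by lra.
  apply: (sturm_pair_coprime t12) => //.
  move: St; rewrite tE sturm_pair_SN1 => /eqP; rewrite mulf_eq0 gt_eqF ?(lt_trans _ g2) //.
  by move=> /eqP.
- have tE : t = 1 by lra.
  by move: Qt; rewrite tE Q1 => /eqP; rewrite oner_eq0.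
- exact: (sturm_pair_coprime t12).
Qed.

Lemma damp_gt0 t : -1 <= t <= 1 -> 0 < (damp g).[t].
Proof.
move=> /andP[t1 t2]; rewrite /damp !hornerE.
have -> : g + (1 - g) * t = (1 - t) * (g - 2^-1) + (1 + t) * 2^-1 by field.
move: t2; rewrite le_eqVlt => /predU1P[->|t2].
  by rewrite subrr mul0r add0r mulr_gt0 // invr_gt0.
rewrite ltr_pwDl ?mulr_gt0 ?subr_gt0 // mulr_ge0 ?invr_ge0 //; lra.
Qed.

(** The derivative of the speed involves only the speed and [Q * S], and the sign of the latter is
    known wherever the speed is nonpositive. *)
Lemma speed_deriv t : (1 - t ^+ 2) * (speed g l Q S)^`().[t] =
  (damp_deriv g).[t] * ((speed g l Q S).[t] - Q.[t] * S.[t]).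
Proof.
have := dQt t; have := dSt t.
rewrite /speed /amp /damp /damp_deriv.
rewrite !(derivD, derivB, derivN, derivM, derivX, derivC) !hornerE.
move: Q^`().[t] S^`().[t] Q.[t] S.[t] => q' s' q s Es Eq.
apply/eqP; rewrite -subr_eq0; apply/eqP.
pose G := g + (1 - g) * t.
(* The multipliers of the two first-order equations are [1 - t] and [1 + t] times the partial
   derivatives of the speed in [Q] and in [S]. *)
transitivity ((1 - t) * (2 * l ^+ 2 * (1 + t) * q - G * s) *
    ((1 + t) * q' - (s - g * q)) +
  (1 + t) * (2 * (1 - t) * s - G * q) * ((1 - t) * s' - (s - l ^+ 2 * q))).
  by rewrite /G /=; ring.
by rewrite Eq Es !subrr !mulr0 addr0.
Qed.

Lemma speed_le0 t : -1 <= t <= 1 -> (speed g l Q S).[t] <= 0 ->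
  (speed g l Q S).[t] - Q.[t] * S.[t] < 0.
Proof.
move=> t12 D0; have G0 := damp_gt0 t12; have A0 := amp_gt0 t12.
have QS0 : 0 < Q.[t] * S.[t].
  rewrite -(pmulr_rgt0 _ G0) (lt_le_trans A0) // mulrA -!hornerM -subr_le0.
  by move: D0; rewrite /speed hornerD hornerN.
by rewrite subr_lt0 (le_lt_trans D0).
Qed.

Let speed1 : 0 < (speed g l Q S).[1].
Proof.
have -> : (speed g l Q S).[1] = l ^+ 2.
  by rewrite /speed /amp /damp !hornerE /= Q1 sturm_pair_S1; ring.
by rewrite exprn_gt0.
Qed.

Let speedN1 : 0 < (speed g l Q S).[-1].
Proof.
have g0 : 0 < g by apply: lt_trans g2.
have -> : (speed g l Q S).[-1] = (2 * g)^-1 * (amp l Q S).[-1].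
  rewrite /speed /amp /damp !hornerE /= sturm_pair_SN1; field.
  by rewrite gt_eqF.
by rewrite mulr_gt0 ?invr_gt0 ?mulr_gt0 // amp_gt0 // lexx /=; lra.
Qed.

(* Where the speed is nonpositive, its derivative has the sign of
   [- damp_deriv g], which pushes its minimum to an endpoint of [-1, 1]. *)
Lemma speed_gt0 t : -1 <= t <= 1 -> 0 < (speed g l Q S).[t].
Proof.
move=> /andP[t1 t2]; rewrite ltNge; apply/negP => Dt.
have D1 := speed1; have DN := speedN1.
set D := speed g l Q S in Dt D1 DN *.
have cD A : {within A, continuous (horner D)}.
  by apply: continuous_subspaceT; exact: continuous_horner.
have g0 : 0 < g by exact: lt_trans g2.
pose h : {poly R} := Q * S - D.
have near0 (y : R) : -1 <= y <= 1 -> D.[y] <= 0 ->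
    exists2 e, 0 < e & forall z, `|z - y| < e -> 0 < h.[z].
  move=> y12 Dy; apply: continuous_gt0; first exact: continuous_horner.
  have := speed_le0 y12 Dy; rewrite -/D /h !hornerE; lra.
have sgn (c : R) : -1 < c < 1 -> 0 < h.[c] ->
    (0 < (damp_deriv g).[c] -> D^`().[c] < 0) /\
    ((damp_deriv g).[c] < 0 -> 0 < D^`().[c]).
  move=> /andP[c1 c2] hc; have := speed_deriv c; rewrite -/D.
  have c0 : 0 < 1 - c ^+ 2 by nra.
  have -> : D.[c] - Q.[c] * S.[c] = - h.[c] by rewrite /h !hornerE opprB.
  rewrite mulrN => E; split => e0.
    by rewrite -(pmulr_rlt0 _ c0) E oppr_lt0 mulr_gt0.
  by rewrite -(pmulr_rgt0 _ c0) E oppr_gt0 nmulr_rlt0.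
(* [damp_deriv g] is increasing, so its sign at [t] persists to the right of [t] if nonnegative and
   to the left otherwise. The speed is minimised over that side; a small step from the minimiser
   away from [t] would lower it further. *)
have [e0|e0] := leP 0 (damp_deriv g).[t].
  have [y /[!in_itv]/= /andP[ty y1] ymin] := EVT_min t2 (cD _).
  have Dy : D.[y] <= 0 by apply: le_trans Dt; apply: ymin; rewrite in_itv /= lexx.
  have y1' : y < 1.
    by rewrite lt_neqAle y1 andbT; apply/eqP => yE; rewrite yE leNgt D1 in Dy.
  have [|e ep He] := near0 y _ Dy; first by rewrite y1 (le_trans t1).
  pose z := Num.min (y + e / 2) 1.
  have yz : y < z by rewrite lt_min y1' andbT; lra.
  have z1 : z <= 1 by rewrite ge_min lexx orbT.
  have ze : z <= y + e / 2 by rewrite ge_min lexx.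
  have [c] := @MVT R _ (fun x => D^`().[x]) y z yz (fun x _ => is_derive_horner D x) (cD _).
  rewrite in_itv /= => /andP[yc cz] E.
  have : D.[y] <= D.[z] by apply: ymin; rewrite in_itv /= z1 (le_trans ty) ?ltW.
  rewrite -subr_ge0 E pmulr_lge0 ?subr_gt0 // leNgt => /negP; apply.
  apply: (proj1 (sgn c _ _)); first by apply/andP; split; lra.
    by apply: He; rewrite ger0_norm; lra.
  have gct : 0 < g * (c - t) by rewrite mulr_gt0 // subr_gt0 (le_lt_trans ty).
  by move: e0; rewrite /damp_deriv !hornerE /=; lra.
have [y /[!in_itv]/= /andP[y1 yt] ymin] := EVT_min t1 (cD _).
have Dy : D.[y] <= 0 by apply: le_trans Dt; apply: ymin; rewrite in_itv /= t1 lexx.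
have y1' : -1 < y.
  by rewrite lt_neqAle y1 andbT; apply/eqP => yE; rewrite -yE leNgt DN in Dy.
have [|e ep He] := near0 y _ Dy; first by rewrite y1 (le_trans yt).
pose z := Num.max (y - e / 2) (-1).
have yz : z < y by rewrite gt_max y1' andbT; lra.
have z1 : -1 <= z by rewrite le_max lexx orbT.
have ze : y - e / 2 <= z by rewrite le_max lexx.
have [c] := @MVT R _ (fun x => D^`().[x]) z y yz (fun x _ => is_derive_horner D x) (cD _).
rewrite in_itv /= => /andP[zc cy] E.
have : D.[y] <= D.[z].
  by apply: ymin; rewrite in_itv /= z1 /= (le_trans (ltW yz)).
rewrite -subr_le0 E pmulr_lle0 ?subr_gt0 // leNgt => /negP; apply.
apply: (proj2 (sgn c _ _)); first by apply/andP; split; lra.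
  by apply: He; rewrite distrC ger0_norm; lra.
have gct : 0 < g * (t - c) by rewrite mulr_gt0 // subr_gt0 (lt_le_trans cy).
by move: e0; rewrite /damp_deriv !hornerE /=; lra.
Qed.

End SturmPair.

(** * The Pruefer angle *)

Section Pruefer.
Variable R : realType.
Implicit Types (g l t x : R) (Q S : {poly R}).

Lemma is_derive0_cst (f : R -> R) a b : a <= b ->
  (forall x, a <= x <= b -> is_derive x 1 f 0) -> f b = f a.
Proof.
move=> ab Df.
have [||c _] := @MVT_segment R f (fun=> 0) a b ab.
- by move=> x; rewrite in_itv /= => /andP[ax xb]; apply: Df; rewrite !ltW.
- by apply: derivable_within_continuous => x; rewrite in_itv /= => /Df[].
by rewrite mul0r => /eqP; rewrite subr_eq0 => /eqP.
Qed.

(** The quotient is the squared sine of the difference between [psi] and the polar angle of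
    [(X, Y)]; the last hypothesis says that both angles turn at the same rate. *)
Lemma angle_conserved (X Y psi : R -> R) (dX dY w y : R) :
  is_derive y 1 X dX -> is_derive y 1 Y dY -> is_derive y 1 psi w ->
  X y ^+ 2 + Y y ^+ 2 != 0 ->
  (X y ^+ 2 + Y y ^+ 2) * w = X y * dY - Y y * dX ->
  is_derive y 1 (fun z => (X z * sin (psi z) - Y z * cos (psi z)) ^+ 2 /
    (X z ^+ 2 + Y z ^+ 2)) 0.
Proof.
move=> Dx Dy Dp N0 E.
have Ds := is_derive1_comp (is_derive_sin (psi y)) Dp.
have Dc := is_derive1_comp (is_derive_cos (psi y)) Dp.
have DZ := is_deriveX 2 (is_deriveB (is_deriveM Dx Ds) (is_deriveM Dy Dc)).
have n0 : (X * X + Y * Y) y != 0 by rewrite fctE -!expr2.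
have DV := is_deriveV n0 (is_deriveD (is_deriveM Dx Dx) (is_deriveM Dy Dy)).
have D := is_deriveM DZ DV.
rewrite (_ : (fun _ => _) = (X * (sin \o psi) - Y * (cos \o psi)) ^+ 2 *
  (fun z => ((X * X + Y * Y) z)^-1)); last first.
  by apply/funext => z; rewrite !fctE -!expr2.
refine (@is_derive_eq _ _ _ _ _ _ _ _ D _).
rewrite /GRing.scale !fctE /= ?fctE /= -!expr2.
move: (X y) (Y y) (sin (psi y)) (cos (psi y)) N0 E => x z s c N0 E.
have -> : w = (x * dY - z * dX) / (x ^+ 2 + z ^+ 2) by rewrite -E mulrC mulKf.
by field.
Qed.

(* [cos (2 x)]: below, [x] is half the angle [theta] with [t = cos theta]. *)
Definition dbl x := cos x ^+ 2 - sin x ^+ 2.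

Lemma dblDl x : 1 + dbl x = 2 * cos x ^+ 2.
Proof. by have := cos2Dsin2 x; rewrite /dbl; lra. Qed.

Lemma dblBl x : 1 - dbl x = 2 * sin x ^+ 2.
Proof. by have := cos2Dsin2 x; rewrite /dbl; lra. Qed.

Lemma dbl_itv x : -1 <= dbl x <= 1.
Proof.
have := dblDl x; have := dblBl x; have := sqr_ge0 (cos x); have := sqr_ge0 (sin x).
by move=> *; apply/andP; split; lra.
Qed.

Lemma is_derive_dbl x : is_derive x 1 dbl (- 4 * sin x * cos x).
Proof.
have -> : dbl = cos * cos - sin * sin.
  by apply/funext => y; rewrite /dbl !expr2.
have c := @is_derive_cos R x; have s := @is_derive_sin R x.
apply: is_derive_eq; rewrite /GRing.scale /=; ring.
Qed.

Lemma is_derive_horner_dbl p x :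
  is_derive x 1 (fun y => p.[dbl y]) (p^`().[dbl x] * (- 4 * sin x * cos x)).
Proof.
exact: (is_derive1_comp (is_derive_horner p (dbl x)) (is_derive_dbl x)).
Qed.

Definition psi_rate g l Q S x :=
  2 * l * (speed g l Q S).[dbl x] / (amp l Q S).[dbl x].

(** The last two clauses say that [(l cos x Q, sin x S)] is a positive multiple of
    [(cos psi, sin psi)], so critical points of [F] appear as zeros of [sin psi]. The interval of
    the derivative contains [[0, pi / 2]] in its interior, which makes it two-sided at the ends. *)
Definition pruefer g l Q S (psi : R -> R) :=
  [/\ psi 0 = 0,
      forall x, -1 < x < pi -> is_derive x 1 psi (psi_rate g l Q S x),
      forall x, 0 <= x <= pi / 2 ->
        l * cos x * Q.[dbl x] * sin (psi x) = sin x * S.[dbl x] * cos (psi x) &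
      forall x, 0 <= x <= pi / 2 ->
        0 < l * cos x * Q.[dbl x] * cos (psi x) + sin x * S.[dbl x] * sin (psi x)].

Variables (g l : R) (Q S : {poly R}).
Hypotheses (g2 : 2^-1 < g) (QS : sturm_pair g l Q S).

Let l0 : 0 < l. Proof. by case: QS. Qed.
Let Q1 : Q.[1] = 1. Proof. by case: QS. Qed.
Let amp0 x : 0 < (amp l Q S).[dbl x].
Proof. exact: (amp_gt0 g2 QS (dbl_itv x)). Qed.

Lemma psi_rate_gt0 x : 0 < psi_rate g l Q S x.
Proof.
by rewrite divr_gt0 ?mulr_gt0 // (speed_gt0 g2 QS (dbl_itv x)).
Qed.

Lemma dampE x : (damp g).[dbl x] = cos x ^+ 2 + (2 * g - 1) * sin x ^+ 2.
Proof.
rewrite /damp !hornerE /= cos2sin2 /dbl cos2sin2; ring.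
Qed.

Lemma ampE x : (amp l Q S).[dbl x] =
  2 * ((l * cos x * Q.[dbl x]) ^+ 2 + (sin x * S.[dbl x]) ^+ 2).
Proof.
transitivity (l ^+ 2 * (1 + dbl x) * Q.[dbl x] ^+ 2 +
  (1 - dbl x) * S.[dbl x] ^+ 2); first by rewrite /amp !hornerE /=; ring.
by rewrite dblDl dblBl; ring.
Qed.

Let X x := l * cos x * Q.[dbl x].
Let Y x := sin x * S.[dbl x].

Let DX x : is_derive x 1 X ((2 * g - 1) * l * sin x * Q.[dbl x] - 2 * l * Y x).
Proof.
have -> : X = (cst l * cos * (fun y => Q.[dbl y])) by [].
have c := @is_derive_cos R x; have d := is_derive_horner_dbl Q x.
apply: is_derive_eq; rewrite /GRing.scale ?fctE /= /Y.
have E : S.[dbl x] = 2 * cos x ^+ 2 * Q^`().[dbl x] + g * Q.[dbl x].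
  by case: QS => _ _ -> _; rewrite -dblDl /jacobi_aux !hornerE /=; ring.
by rewrite E; ring.
Qed.

Let DY x : is_derive x 1 Y (2 * l * X x - cos x * S.[dbl x]).
Proof.
have -> : Y = (sin * (fun y => S.[dbl y])) by [].
have c := @is_derive_sin R x; have d := is_derive_horner_dbl S x.
apply: is_derive_eq; rewrite /GRing.scale ?fctE /= /X.
have E : 2 * sin x ^+ 2 * S^`().[dbl x] = S.[dbl x] - l ^+ 2 * Q.[dbl x].
  case: QS => _ _ _ /(congr1 (horner^~ (dbl x))).
  by rewrite -dblBl !hornerE /= => <-; ring.
transitivity (- 2 * cos x * (2 * sin x ^+ 2 * S^`().[dbl x]) + cos x * S.[dbl x]);
  first by ring.
by rewrite E; ring.
Qed.

Let rateE x : (X x ^+ 2 + Y x ^+ 2) * psi_rate g l Q S x =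
  X x * (2 * l * X x - cos x * S.[dbl x]) -
  Y x * ((2 * g - 1) * l * sin x * Q.[dbl x] - 2 * l * Y x).
Proof.
have A0 : (amp l Q S).[dbl x] != 0 by rewrite gt_eqF.
have -> : X x ^+ 2 + Y x ^+ 2 = 2^-1 * (amp l Q S).[dbl x].
  by rewrite ampE /X /Y; field.
rewrite /psi_rate /speed hornerD hornerN !hornerM dampE.
transitivity (l * ((amp l Q S).[dbl x] - (cos x ^+ 2 + (2 * g - 1) * sin x ^+ 2)
  * Q.[dbl x] * S.[dbl x])); first by field.
by rewrite ampE /X /Y; ring.
Qed.

Lemma pruefer_exists : exists psi, pruefer g l Q S psi.
Proof.
have dblC : continuous dbl.
  by move=> x; exact: is_derive_continuous (is_derive_dbl x).
have hC p : continuous (fun x => p.[dbl x]).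
  by move=> x; exact: is_derive_continuous (is_derive_horner_dbl p x).
have rC : continuous (psi_rate g l Q S).
  move=> x; apply: cvgM; first by apply: cvgM; [exact: cvg_cst|exact: hC].
  by apply: cvgV; [rewrite gt_eqF|exact: hC].
have [psi psi0 Dpsi] := antiderivative pi (ltrN10 R) rC.
have pi2 x : 0 <= x <= pi / 2 -> -1 < x < pi.
  by have := pi_gt0 R; move=> p0 /andP[x0 x1]; apply/andP; split; lra.
have NE x : X x ^+ 2 + Y x ^+ 2 = 2^-1 * (amp l Q S).[dbl x].
  by rewrite ampE /X /Y; field.
have N0 x : X x ^+ 2 + Y x ^+ 2 != 0.
  by rewrite NE mulf_neq0 ?gt_eqF ?invr_gt0.
have Z0 x : 0 <= x <= pi / 2 -> X x * sin (psi x) - Y x * cos (psi x) = 0.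
  move=> /andP[x0 xp].
  pose V := (fun y => (X y * sin (psi y) - Y y * cos (psi y)) ^+ 2 /
    (X y ^+ 2 + Y y ^+ 2)).
  have : V x = V 0.
    apply: (is_derive0_cst x0) => y /andP[y0 yx].
    have /pi2 yp : 0 <= y <= pi / 2 by rewrite y0 (le_trans yx).
    have Dp := Dpsi _ yp.
    exact: (@angle_conserved X Y psi _ _ _ y (DX y) (DY y) (Dpsi _ yp) (N0 y) (rateE y)).
  rewrite /V psi0 sin0 mulr0 /Y sin0 !mul0r subr0 expr0n mul0r => /eqP.
  by rewrite mulf_eq0 invr_eq0 (negbTE (N0 x)) orbF sqrf_eq0 => /eqP.
exists psi; split => // x xp; first by apply/eqP; rewrite -subr_eq0 -/(X x) Z0.
(* The component of [(X, Y)] orthogonal to [(cos psi, sin psi)] is zero, so [U] never vanishes, and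
   [U 0 = l] fixes its sign. *)
pose U z := X z * cos (psi z) + Y z * sin (psi z).
rewrite ltNge; apply/negP => Ux.
have U2 z : 0 <= z <= pi / 2 -> U z != 0.
  move=> zp; apply: contraNneq (N0 z) => Uz.
  have := cos2Dsin2 (psi z) => cs; rewrite -[X in X == 0]mulr1 -cs.
  have -> : (X z ^+ 2 + Y z ^+ 2) * (cos (psi z) ^+ 2 + sin (psi z) ^+ 2) =
    U z ^+ 2 + (X z * sin (psi z) - Y z * cos (psi z)) ^+ 2 by rewrite /U; ring.
  by rewrite Uz Z0 // expr0n addr0.
have /andP[x0 xp2] := xp.
have [||z /[!in_itv]/= /andP[z0 zx] Uz] := @IVT R U 0 x 0 x0.
- apply: derivable_within_continuous => y; rewrite in_itv /= => /andP[y0 yx].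
  have /pi2 yp : 0 <= y <= pi / 2 by rewrite y0 (le_trans yx).
  have Dp := Dpsi _ yp.
  have Ds := is_derive1_comp (is_derive_sin (psi y)) Dp.
  have Dc := is_derive1_comp (is_derive_cos (psi y)) Dp.
  by have [] := is_deriveD (is_deriveM (DX y) Dc) (is_deriveM (DY y) Ds).
- rewrite ge_min le_max Ux orbT /= /U psi0 cos0 sin0 mulr0 addr0 mulr1 /X cos0 mulr1.
  by rewrite /dbl cos0 sin0 expr1n expr0n subr0 Q1 mulr1 ltW.
by have := U2 z; rewrite Uz eqxx z0 (le_trans zx) //= => /(_ isT).
Qed.

End Pruefer.

(** * Angular rate and energy along the Pruefer angle *)

Section PrueferFacts.
Variables (R : realType) (g l : R) (Q S : {poly R}) (psi : R -> R).
Hypotheses (g2 : 2^-1 < g) (QS : sturm_pair g l Q S) (psiP : pruefer g l Q S psi).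
Implicit Types x y : R.

Let l0 : 0 < l. Proof. by case: QS. Qed.
Let amp0 x : 0 < (amp l Q S).[dbl x].
Proof. exact: (amp_gt0 g2 QS (dbl_itv x)). Qed.

Lemma dbl0 : dbl 0 = 1 :> R.
Proof. by rewrite /dbl cos0 sin0 expr1n expr0n subr0. Qed.

Lemma dbl_pihalf : dbl (pi / 2) = -1 :> R.
Proof. by rewrite /dbl cos_pihalf sin_pihalf expr1n expr0n sub0r. Qed.

Lemma pruefer_polar x : 0 <= x <= pi / 2 -> exists2 r, 0 < r &
  l * cos x * Q.[dbl x] = r * cos (psi x) /\ sin x * S.[dbl x] = r * sin (psi x).
Proof.
move=> xp; have [_ _ /(_ _ xp) E /(_ _ xp) r0] := psiP.
set X := l * _ * _ in E r0 *; set Y := sin x * _ in E r0 *.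
exists (X * cos (psi x) + Y * sin (psi x)) => //.
have cs := cos2Dsin2 (psi x).
move: (sin (psi x)) (cos (psi x)) cs E {r0} => s c cs E; split.
  transitivity (X * (c ^+ 2 + s ^+ 2)); first by rewrite cs mulr1.
  by rewrite mulrDr [X * s ^+ 2]mulrA E; ring.
transitivity (Y * (c ^+ 2 + s ^+ 2)); first by rewrite cs mulr1.
by rewrite mulrDr [Y * c ^+ 2]mulrA -E; ring.
Qed.

Definition dsin x := 2 * sin x * cos x.

(** This is [psi' = 2 l - 2 sin psi cos psi / m] in the half-angle, multiplied by
    [dsin x = sin theta] so that it makes sense at the ends. *)
Lemma psi_rateE x : 0 <= x <= pi / 2 -> dsin x * psi_rate g l Q S x =
  2 * (l * dsin x) - 2 * ((damp g).[dbl x] * (sin (psi x) * cos (psi x))).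
Proof.
move=> /pruefer_polar[r r0 [EX EY]].
have Ea : (amp l Q S).[dbl x] = 2 * r ^+ 2.
  by rewrite ampE EX EY !exprMn -mulrDr cos2Dsin2 mulr1.
have r0' : r != 0 by rewrite gt_eqF.
rewrite /psi_rate Ea /speed hornerD hornerN !hornerM Ea.
transitivity (2 * (l * dsin x) - 2 * (damp g).[dbl x] *
  ((l * cos x * Q.[dbl x]) * (sin x * S.[dbl x])) / r ^+ 2).
  by rewrite /dsin; field.
by rewrite EX EY; field.
Qed.

(** At both ends [dsin] vanishes and [psi_rateE] is void; the comparison of rates there rests on
    this value and the next one. *)
Lemma psi_rate0 : psi_rate g l Q S 0 = l.
Proof.
have := sturm_pair_S1 QS; have [_ Q1 _ _] := QS => S1.
have l0' : l != 0 by rewrite gt_eqF.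
rewrite /psi_rate dbl0 /speed /amp /damp !hornerE /= S1 Q1; field.
by rewrite l0'.
Qed.

Lemma psi_rate_pihalf : psi_rate g l Q S (pi / 2) = l / g.
Proof.
have g0 : g != 0 by rewrite gt_eqF // (lt_trans _ g2).
have := sturm_pair_SN1 QS => S1.
have A0 : (amp l Q S).[-1] != 0.
  by have := amp0 (pi / 2); rewrite dbl_pihalf => /lt0r_neq0.
rewrite /psi_rate dbl_pihalf.
have -> : (speed g l Q S).[-1] = (2 * g)^-1 * (amp l Q S).[-1].
  by rewrite /speed /amp /damp !hornerE /= S1; field.
by field; rewrite g0.
Qed.

Lemma pruefer_mono x y : -1 < x -> x < y -> y < pi -> psi x < psi y.
Proof.
move=> x1 xy yp; have [_ Dp _ _] := psiP.
have [||c] := @MVT R psi (psi_rate g l Q S) x y xy.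
- move=> z; rewrite in_itv /= => /andP[xz zy]; apply: Dp.
  by rewrite (lt_trans x1) ?(lt_trans zy).
- apply: derivable_within_continuous => z; rewrite in_itv /= => /andP[xz zy].
  have zi : -1 < z < pi by rewrite (lt_le_trans x1) ?(le_lt_trans zy).
  by have [] := Dp _ zi.
by move=> _ E; rewrite -subr_gt0 E mulr_gt0 ?subr_gt0 // psi_rate_gt0.
Qed.

(** Up to an additive constant, the logarithm of the energy [l^2 F^2 + (dF/dtheta)^2]. *)
Definition lnamp x := 2 * (2 * g - 1) * ln (cos x) + ln (amp l Q S).[dbl x].

Lemma is_derive_lnamp x : 0 <= x < pi / 2 -> is_derive x 1 lnamp
  (- 4 * (sin x / cos x) * (damp g).[dbl x] * S.[dbl x] ^+ 2 / (amp l Q S).[dbl x]).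
Proof.
move=> /andP[x0 xp].
have c0 : 0 < cos x.
  by apply: cos_gt0_pihalf; rewrite xp andbT (lt_le_trans _ x0) // oppr_lt0 divr_gt0 ?pi_gt0.
have D1 := is_derive1_comp (is_derive1_ln c0) (is_derive_cos x).
have D2 := @is_derive1_comp R (@ln R) (fun y => (amp l Q S).[dbl y]) x _ _
  (is_derive1_ln (amp0 x)) (is_derive_horner_dbl (amp l Q S) x).
have D := is_deriveD (is_deriveM (is_derive_cst (2 * (2 * g - 1)) x 1) D1) D2.
rewrite (_ : lnamp = cst (2 * (2 * g - 1)) * (@ln R \o @cos R) +
  (@ln R \o (fun y => (amp l Q S).[dbl y]))); last by apply/funext.
refine (@is_derive_eq _ _ _ _ _ _ _ _ D _).
rewrite /GRing.scale !fctE /=.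
have Ea : 2 * cos x ^+ 2 * (amp l Q S)^`().[dbl x] =
    2 * (damp g).[dbl x] * S.[dbl x] ^+ 2 - (2 * g - 1) * (amp l Q S).[dbl x].
  have [_ _ EQ ES] := QS.
  have dQ : (1 + dbl x) * Q^`().[dbl x] = S.[dbl x] - g * Q.[dbl x].
    by rewrite [in RHS]EQ /jacobi_aux !hornerE /=; ring.
  have dS : (1 - dbl x) * S^`().[dbl x] = S.[dbl x] - l ^+ 2 * Q.[dbl x].
    by move/(congr1 (horner^~ (dbl x))): ES; rewrite !hornerE /= => <-; ring.
  move: dQ dS; rewrite -dblDl; move: (dbl x) => t dQ dS.
  rewrite /amp /damp !(derivD, derivB, derivN, derivM, derivX, derivC) !hornerE /=.
  move: Q^`().[t] S^`().[t] dQ dS => q' s' dQ dS.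
  transitivity ((1 + t) * (l ^+ 2 * Q.[t] ^+ 2 - S.[t] ^+ 2) +
    2 * l ^+ 2 * (1 + t) * Q.[t] * ((1 + t) * q') +
    2 * (1 + t) * S.[t] * ((1 - t) * s')); first by ring.
  by rewrite dQ dS; ring.
have c0' : cos x != 0 by rewrite gt_eqF.
have A0 : (amp l Q S).[dbl x] != 0 by rewrite gt_eqF.
transitivity (- 2 * (2 * g - 1) * (sin x / cos x) - 2 * (sin x / cos x) *
  (2 * cos x ^+ 2 * (amp l Q S)^`().[dbl x]) / (amp l Q S).[dbl x]).
  by field; rewrite c0' A0.
by rewrite Ea; field; rewrite c0' A0.
Qed.

Lemma lnamp_rateE x : 0 <= x < pi / 2 ->
  dsin x * (- 4 * (sin x / cos x) * (damp g).[dbl x] * S.[dbl x] ^+ 2 /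
    (amp l Q S).[dbl x]) = - 4 * ((damp g).[dbl x] * sin (psi x) ^+ 2).
Proof.
move=> /andP[x0 xp].
have c0 : cos x != 0.
  rewrite gt_eqF //; apply: cos_gt0_pihalf.
  by rewrite xp andbT (lt_le_trans _ x0) // oppr_lt0 divr_gt0 ?pi_gt0.
have [|r r0 [EX EY]] := @pruefer_polar x; first by rewrite x0 ltW.
have Ea : (amp l Q S).[dbl x] = 2 * r ^+ 2.
  by rewrite ampE EX EY !exprMn -mulrDr cos2Dsin2 mulr1.
have r0' : r != 0 by rewrite gt_eqF.
rewrite Ea; transitivity (- 4 * (damp g).[dbl x] * (sin x * S.[dbl x]) ^+ 2 / r ^+ 2).
  by rewrite /dsin; field; rewrite r0' c0.
by rewrite EY; field.
Qed.

(* At a critical point of [F := (1 + t)^g * Q] the amplitude is [|F|]. *)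
Lemma lnamp_crit x : 0 <= x < pi / 2 -> sin (psi x) = 0 ->
  Q.[dbl x] != 0 /\
  lnamp x = ln (2 * l ^+ 2) + 2 * ln ((cos x ^+ 2) `^ g * `|Q.[dbl x]|).
Proof.
move=> /andP[x0 xp] s0.
have c0 : 0 < cos x.
  by apply: cos_gt0_pihalf; rewrite xp andbT (lt_le_trans _ x0) // oppr_lt0 divr_gt0 ?pi_gt0.
have [|r r0 [EX EY]] := @pruefer_polar x; first by rewrite x0 ltW.
have Q0 : Q.[dbl x] != 0.
  apply/eqP => Qx; move/eqP: EX; rewrite Qx mulr0 eq_sym mulf_eq0 gt_eqF //=.
  move=> /eqP cx; have := cos2Dsin2 (psi x); rewrite cx s0 expr0n addr0.
  by move/eqP; rewrite eq_sym oner_eq0.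
split => //; have q0 : 0 < `|Q.[dbl x]| by rewrite normr_gt0.
rewrite /lnamp ampE EY s0 mulr0 expr0n addr0.
have -> : 2 * (l * cos x * Q.[dbl x]) ^+ 2 =
    (2 * l ^+ 2) * (cos x ^+ 2 * `|Q.[dbl x]| ^+ 2).
  by rewrite real_normK ?num_real //; ring.
have c2 : 0 < cos x ^+ 2 by rewrite exprn_gt0.
rewrite !lnM ?posrE ?mulr_gt0 ?exprn_gt0 ?powR_gt0 //.
rewrite ln_powR !lnXn //; ring.
Qed.

End PrueferFacts.

(** * Comparison of two parameters *)

Section Matching.
Variables (R : realType) (g l1 l2 : R) (Q1 S1 Q2 S2 : {poly R}) (psi1 psi2 : R -> R).
Hypotheses (g23 : 2 / 3 <= g) (l12 : l1 < l2).
Hypotheses (QS1 : sturm_pair g l1 Q1 S1) (QS2 : sturm_pair g l2 Q2 S2).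
Hypotheses (P1 : pruefer g l1 Q1 S1 psi1) (P2 : pruefer g l2 Q2 S2 psi2).
Implicit Types x y : R.

Let g2 : 2^-1 < g. Proof. by have := g23; lra. Qed.
Let l10 : 0 < l1. Proof. by case: QS1. Qed.
Let l20 : 0 < l2. Proof. by case: QS2. Qed.
Let rate1 := psi_rate g l1 Q1 S1.
Let rate2 := psi_rate g l2 Q2 S2.
Let pi0 : 0 < pi :> R := pi_gt0 R.

Lemma quarter_itv x : 0 <= x <= pi / 2 -> -1 < x < pi.
Proof. by move=> /andP[x0 xp]; apply/andP; split; have := pi0; lra. Qed.

Lemma dsin_gt0 x : 0 < x < pi / 2 -> 0 < dsin x.
Proof.
move=> /andP[x0 xp]; rewrite /dsin !mulr_gt0 ?sin_gt0_pihalf ?x0 //.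
by rewrite cos_gt0_pihalf // xp andbT; lra.
Qed.

(** At equal angles the rates given by [psi_rateE] differ only through [l], so at every contact the
    angle with the larger [l] is faster. *)
Lemma pruefer_lt x : 0 < x <= pi / 2 -> psi1 x < psi2 x.
Proof.
move=> xp; rewrite -subr_gt0.
have [p10 D1 _ _] := P1; have [p20 D2 _ _] := P2.
apply: (@contact R (fun y => psi2 y - psi1 y) (fun y => rate2 y - rate1 y) 0 (pi / 2)) => //.
- move=> y /andP[y0 yp]; apply: is_deriveB.
    by apply: D2; rewrite quarter_itv ?y0.
  by apply: D1; rewrite quarter_itv ?y0.
- by rewrite p10 p20 subrr.
move=> y /andP[y0 yp] E; rewrite subr_gt0.
have [->|yn0] := eqVneq y 0; first by rewrite /rate1 /rate2 !psi_rate0.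
have [->|ynp] := eqVneq y (pi / 2).
  by rewrite /rate1 /rate2 !psi_rate_pihalf // ltr_pM2r // invr_gt0 (lt_trans _ g2).
have h0 : 0 < dsin y by rewrite dsin_gt0 // !lt_neqAle eq_sym yn0 y0 ynp.
rewrite -(ltr_pM2l h0) (psi_rateE P1) ?y0 // (psi_rateE P2) ?y0 //.
have -> : psi2 y = psi1 y by apply/eqP; rewrite -subr_eq0; apply/eqP.
by rewrite ltrD2r ltr_pM2l // ltr_pM2r.
Qed.

(** [T x] is the point where the second angle takes the value that the first has at [x]; it lies
    before [x] because the second angle is ahead. *)
Lemma matching : exists T : R -> R, [/\ T 0 = 0,
  forall x, 0 <= x <= pi / 2 -> psi2 (T x) = psi1 x,
  forall x, 0 < x <= pi / 2 -> 0 < T x < x &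
  forall x, 0 <= x <= pi / 2 -> is_derive x 1 T (rate1 x / rate2 (T x))].
Proof.
have [p10 D1 _ _] := P1; have [p20 D2 _ _] := P2.
have inj2 x y : -1 < x < pi -> -1 < y < pi -> psi2 x = psi2 y -> x = y.
  move=> /andP[x1 xp] /andP[y1 yp] E; apply/eqP; rewrite eq_le !leNgt.
  apply/andP; split; apply/negP => xy.
    by have := pruefer_mono g2 QS2 P2 y1 xy xp; rewrite E ltxx.
  by have := pruefer_mono g2 QS2 P2 x1 xy yp; rewrite E ltxx.
(* [psi2] is inverted on an open interval around [[0, pi / 2]], so that the inverse is
   differentiable also at the angle reached at 0. *)
pose G v := xget 0 [set y | -1 < y < pi /\ psi2 y = v].
have GK y : -1 < y < pi -> G (psi2 y) = y.
  move=> yp; rewrite /G; case: xgetP => [z _ [zp /inj2 ->] //|/(_ y)].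
  by move=> /= /(_ (conj yp erefl)).
pose T := G \o psi1.
have TP x : 0 <= x <= pi / 2 -> exists2 s, 0 <= s <= x & psi2 s = psi1 x.
  move=> /andP[x0 xp].
  have pp : psi2 0 <= psi1 x <= psi2 x.
    move: x0; rewrite le_eqVlt => /predU1P[<-|x0]; first by rewrite p10 p20 lexx.
    rewrite (ltW (pruefer_lt _)) ?x0 // andbT p20 -p10 ltW //.
    by apply: (pruefer_mono g2 QS1 P1); lra.
  have [||s] := @IVT R psi2 0 x (psi1 x) x0.
  - apply: derivable_within_continuous => z; rewrite in_itv /= => /andP[z0 zx].
    have zi : -1 < z < pi by rewrite quarter_itv // z0 (le_trans zx).
    by have [] := D2 _ zi.
  - have /andP[a1 a2] := pp; have a3 := le_trans a1 a2.
    by rewrite min_l // max_r.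
  by rewrite in_itv /= => sx; exists s.
have TE x s : 0 <= x <= pi / 2 -> 0 <= s <= x -> psi2 s = psi1 x -> T x = s.
  by move=> /andP[x0 xp] /andP[s0 sx] E; rewrite /T /= -E GK // quarter_itv // s0 (le_trans sx).
have psiT x : 0 <= x <= pi / 2 -> 0 <= T x <= x /\ psi2 (T x) = psi1 x.
  by move=> xp; have [s sx E] := TP x xp; rewrite (TE x s).
exists T; split.
- by have [|/le_anti <- //] := psiT 0; rewrite lexx divr_ge0 // ltW.
- by move=> x /psiT[].
- move=> x /andP[x0 xp].
  have [|/andP[T0 Tx] E] := psiT x; first by rewrite ltW.
  rewrite !lt_neqAle T0 Tx !andbT; apply/andP; split; apply/eqP => T0x.
    have /andP[_ xpi] : -1 < x < pi by rewrite quarter_itv // ltW.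
    have : psi1 0 < psi1 x by apply: (pruefer_mono g2 QS1 P1); rewrite ?ltrN10.
    by rewrite -E -T0x p10 p20 ltxx.
  by have := @pruefer_lt x; rewrite x0 xp -E T0x ltxx => /(_ isT).
move=> x xp; have [/andP[T0 Tx] E] := psiT x xp.
have /andP[x0 xp2] := xp.
have Ti : -1 < T x < pi by rewrite quarter_itv // T0 (le_trans Tx).
have nearT : \forall y \near T x, y \in `]-1, pi[ by apply: near_in_itvoo; rewrite in_itv.
have DG : is_derive (psi1 x) 1 G (rate2 (T x))^-1.
  rewrite -E; apply: is_derive_inverse.
  - by apply: filterS nearT => y; rewrite in_itv /= => /GK.
  - apply: filterS nearT => y; rewrite in_itv /= => yi.
    exact: is_derive_continuous (D2 _ yi).
  - exact: D2.
  - by rewrite gt_eqF // psi_rate_gt0.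
have xi := quarter_itv xp.
by rewrite mulrC; apply: is_derive1_comp; exact: D1.
Qed.

(* The [m] of the file header. *)
Definition mloss x := dsin x / (damp g).[dbl x].

Let G0 x : 0 < (damp g).[dbl x]. Proof. exact: damp_gt0 (dbl_itv x). Qed.

Lemma is_derive_mloss x :
  is_derive x 1 mloss (2 * (damp_deriv g).[dbl x] / (damp g).[dbl x] ^+ 2).
Proof.
have D1 := is_deriveM (is_deriveM (is_derive_cst (2 : R) x 1) (is_derive_sin x)) (is_derive_cos x).
have G1 : (fun y => (damp g).[dbl y]) x != 0 by rewrite gt_eqF.
have D2 := @is_deriveV R (fun y => (damp g).[dbl y]) x _ _ G1
  (is_derive_horner_dbl (damp g) x).
have D := is_deriveM D1 D2.
rewrite (_ : mloss = cst (2 : R) * @sin R * @cos R *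
  (fun y => ((fun y => (damp g).[dbl y]) y)^-1)); last by apply/funext.
refine (@is_derive_eq _ _ _ _ _ _ _ _ D _).
rewrite /GRing.scale !fctE /=.
have dG : (damp g)^`().[dbl x] = 1 - g.
  by rewrite /damp !(derivD, derivM, derivX, derivC) !hornerE.
have -> : (damp_deriv g).[dbl x] = g * dbl x + (1 - g) by rewrite /damp_deriv !hornerE /=; ring.
have G2 : (damp g).[dbl x] != 0 by rewrite gt_eqF.
have E : 2 * sin x ^+ 2 * (2 * cos x ^+ 2) = (1 - dbl x) * (1 + dbl x).
  by rewrite dblDl dblBl.
transitivity ((2 * dbl x * (damp g).[dbl x] + 2 * (1 - g) *
  (2 * sin x ^+ 2 * (2 * cos x ^+ 2))) / (damp g).[dbl x] ^+ 2).
  by rewrite dG {3}/dbl; field.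
rewrite E; have -> : (damp g).[dbl x] = g + (1 - g) * dbl x by rewrite /damp !hornerE.
by congr (_ / _); ring.
Qed.

(* This is where [2 / 3 <= g] is needed: [damp_deriv g / damp g ^ 2] increases
   where it is positive. *)
Lemma damp_deriv_compare t s : -1 <= t -> t < s -> s <= 1 ->
  (1 - s ^+ 2) * (damp g).[t] ^+ 2 < (1 - t ^+ 2) * (damp g).[s] ^+ 2 ->
  0 < (damp_deriv g).[s] /\
  (damp_deriv g).[t] * (damp g).[s] ^+ 2 <= (damp_deriv g).[s] * (damp g).[t] ^+ 2.
Proof.
move=> t1 ts s1.
have Gt : 0 < (damp g).[t] by apply: damp_gt0 => //; rewrite t1 (le_trans (ltW ts)).
have Gs : 0 < (damp g).[s] by apply: damp_gt0 => //; rewrite s1 (le_trans t1) ?ltW.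
have ED r : (damp_deriv g).[r] = g * r + (1 - g) by rewrite /damp_deriv !hornerE /=; ring.
have EG r : (damp g).[r] = g + (1 - g) * r by rewrite /damp !hornerE.
rewrite -subr_gt0.
have -> : (1 - t ^+ 2) * (damp g).[s] ^+ 2 - (1 - s ^+ 2) * (damp g).[t] ^+ 2 =
  (s - t) * ((damp_deriv g).[t] * (damp g).[s] + (damp_deriv g).[s] * (damp g).[t]).
  by rewrite !ED !EG; ring.
have st : 0 < s - t by rewrite subr_gt0.
rewrite pmulr_rgt0 // => sum0.
have g0 : 0 < g by exact: lt_trans g2.
have es : 0 < (damp_deriv g).[s].
  rewrite ltNge; apply/negP => es.
  have et : (damp_deriv g).[t] <= 0.
    apply: le_trans es; rewrite !ED lerD2r ler_pM2l //.
    exact: ltW.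
  move: sum0; rewrite ltNge => /negP; apply.
  by rewrite -[X in _ <= X](addr0 0) lerD // mulr_le0_ge0 // ltW.
split => //; rewrite -subr_ge0.
(* As [t] and [s] tend to 1 the second factor tends to [3 g - 2], whose sign dictates the bound
   [2 / 3]. *)
have -> : (damp_deriv g).[s] * (damp g).[t] ^+ 2 -
    (damp_deriv g).[t] * (damp g).[s] ^+ 2 =
  (s - t) * ((3 * g - 2) + (1 - g) ^+ 2 * ((1 - t) * (damp_deriv g).[s] + (1 - s))).
  by rewrite !ED !EG; ring.
have t10 : 0 <= 1 - t by rewrite subr_ge0 (le_trans (ltW ts)).
apply: mulr_ge0; first exact: ltW.
apply: addr_ge0; first by have := g23; lra.
apply: mulr_ge0; first exact: sqr_ge0.
by rewrite addr_ge0 ?subr_ge0 // mulr_ge0 // ltW.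
Qed.

(** * Damping and amplitude at matched angles *)

Section Compare.
Variable T : R -> R.
Hypotheses (T0 : T 0 = 0)
  (psiT : forall x, 0 <= x <= pi / 2 -> psi2 (T x) = psi1 x)
  (Tlt : forall x, 0 < x <= pi / 2 -> 0 < T x < x)
  (DT : forall x, 0 <= x <= pi / 2 -> is_derive x 1 T (rate1 x / rate2 (T x))).

Lemma dbl_decr x y : 0 <= x -> x < y -> y <= pi / 2 -> dbl y < dbl x.
Proof.
move=> x0 xy yp; have cxy : cos y < cos x.
  by rewrite ltr_cos // in_itv /=; apply/andP; split; have := pi0; lra.
have y0 : 0 <= cos y by apply: cos_ge0_pihalf; rewrite yp andbT; lra.
have := dblDl x; have := dblDl y => Ey Ex; rewrite -(ltrD2l 1) Ex Ey.
by rewrite ltr_pM2l // ltr_pXn2r // nnegrE // (le_trans y0) // ltW.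
Qed.

Lemma rate_loss l Q S psi x : pruefer g l Q S psi -> 0 < x < pi / 2 ->
  mloss x * psi_rate g l Q S x =
  2 * (l * mloss x - sin (psi x) * cos (psi x)).
Proof.
move=> P /andP[x0 xp]; have := psi_rateE P; move=> /(_ x).
rewrite !ltW // => /(_ isT) E.
have Gx : (damp g).[dbl x] != 0 by rewrite gt_eqF.
by rewrite /mloss mulrAC E; field.
Qed.

Let mloss_gt0 y : 0 < y < pi / 2 -> 0 < mloss y.
Proof. by move=> yp; rewrite divr_gt0 ?dsin_gt0. Qed.

Let T_lt y : 0 < y < pi / 2 -> 0 < T y < y.
Proof. by move=> /andP[y0 yp]; rewrite Tlt // y0 ltW. Qed.

Let T_itv y : 0 < y < pi / 2 -> 0 < T y < pi / 2.
Proof.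
by move=> /[dup] /T_lt /andP[-> /lt_trans H] /andP[_ /H].
Qed.

Let rate_loss1 y : 0 < y < pi / 2 -> mloss y * rate1 y =
  2 * (l1 * mloss y - sin (psi1 y) * cos (psi1 y)).
Proof. exact: rate_loss. Qed.

Let rate_loss2 y : 0 < y < pi / 2 -> mloss (T y) * rate2 (T y) =
  2 * (l2 * mloss (T y) - sin (psi1 y) * cos (psi1 y)).
Proof.
move=> /[dup] yp /andP[y0 yp2]; rewrite -psiT ?ltW //.
by apply: (rate_loss P2); exact: T_itv.
Qed.

Let mloss_sqr y : mloss y ^+ 2 = (1 - dbl y ^+ 2) / (damp g).[dbl y] ^+ 2.
Proof.
have -> : 1 - dbl y ^+ 2 = (1 - dbl y) * (1 + dbl y) by ring.
by rewrite dblDl dblBl /mloss /dsin exprMn exprVn; congr (_ / _); ring.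
Qed.

(** At a contact [T y] has the smaller [mloss], hence by [damp_deriv_compare] at least as large a
    derivative of [mloss], and also the smaller product of [mloss] and rate; together these make the
    difference increase. At 0 its derivative is [2 l1 (1 - k)], so [k < 1] is what starts the
    argument. *)
Lemma loss_compare_lt k x : 0 < k < 1 -> 0 < x < pi / 2 ->
  0 < l2 * mloss (T x) - k * l1 * mloss x.
Proof.
move=> /andP[k0 k1] /andP[x0 xp].
pose dm y := 2 * (damp_deriv g).[dbl y] / (damp g).[dbl y] ^+ 2.
apply: (@contact R (fun y => l2 * mloss (T y) - k * l1 * mloss y)
  (fun y => l2 * (dm (T y) * (rate1 y / rate2 (T y))) - k * l1 * dm y) 0 x).
- move=> y /andP[y0 yx].
  have yp : 0 <= y <= pi / 2 by rewrite y0 ltW // (le_lt_trans yx).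
  have Dm := is_derive1_comp (is_derive_mloss (T y)) (DT yp).
  have D := is_deriveB (is_deriveM (is_derive_cst l2 y 1) Dm)
    (is_deriveM (is_derive_cst (k * l1) y 1) (is_derive_mloss y)).
  refine (@is_derive_eq _ _ _ _ _ _ _ _ D _).
  by rewrite /GRing.scale /= !mulr0 !addr0.
- by rewrite T0 /mloss /dsin sin0 !(mulr0, mul0r) subrr.
- move=> y /andP[]; rewrite le_eqVlt => /predU1P[<- _ _|y0 yx].
    rewrite T0 /rate1 /rate2 (psi_rate0 QS1) (psi_rate0 QS2).
    have -> : dm 0 = 2.
      have E1 : (damp g).[1] = 1 by rewrite /damp !hornerE /=; ring.
      have E2 : (damp_deriv g).[1] = 1 by rewrite /damp_deriv !hornerE /=; ring.
      by rewrite /dm dbl0 E1 E2 expr1n divr1 mulr1.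
    have -> : l2 * (2 * (l1 / l2)) - k * l1 * 2 = 2 * l1 * (1 - k).
      by field; rewrite gt_eqF.
    by rewrite !mulr_gt0 // subr_gt0.
  move=> /eqP; rewrite subr_eq0 => /eqP E.
  have yp : 0 < y < pi / 2 by rewrite y0 (le_lt_trans yx).
  have my := mloss_gt0 yp; have mT := mloss_gt0 (T_itv yp).
  have /andP[Ty0 Tyy] := T_lt yp.
  have yp2 : y <= pi / 2 by rewrite ltW //; case/andP: yp.
  have klm : k * l1 * mloss y < l1 * mloss y.
    by rewrite ltr_pM2r // gtr_pMl.
  have mTy : mloss (T y) < mloss y.
    rewrite -(ltr_pM2l l20) E; apply: (lt_trans klm).
    by rewrite ltr_pM2r.
  have [] := @damp_deriv_compare (dbl y) (dbl (T y)).
  - by have /andP[] := dbl_itv y.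
  - by apply: dbl_decr; rewrite // ltW.
  - by have /andP[] := dbl_itv (T y).
  - have : mloss (T y) ^+ 2 < mloss y ^+ 2 by rewrite ltr_pXn2r // nnegrE ltW.
    by rewrite !mloss_sqr ltr_pdivrMr ?exprn_gt0 // mulrAC ltr_pdivlMr ?exprn_gt0.
  move=> eT0 eTy.
  have dmT : 0 < dm (T y) by rewrite divr_gt0 ?mulr_gt0 ?exprn_gt0.
  have dmy : dm y <= dm (T y).
    rewrite /dm -!mulrA ler_pM2l // ler_pdivrMr ?exprn_gt0 // mulrAC.
    by rewrite ler_pdivlMr ?exprn_gt0.
  have r1 : 0 < rate1 y by exact: psi_rate_gt0.
  have r2 : 0 < rate2 (T y) by exact: psi_rate_gt0.
  have lt : mloss (T y) * rate2 (T y) < mloss y * rate1 y.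
    by rewrite rate_loss1 // rate_loss2 // E ltr_pM2l // ltrD2r.
  rewrite -(pmulr_rgt0 _ (mulr_gt0 my r2)).
  have -> : mloss y * rate2 (T y) *
     (l2 * (dm (T y) * (rate1 y / rate2 (T y))) - k * l1 * dm y) =
     l2 * dm (T y) * (mloss y * rate1 y) - k * l1 * mloss y * rate2 (T y) * dm y.
    by field; rewrite gt_eqF.
  rewrite -E subr_gt0.
  apply: (@le_lt_trans _ _ (l2 * dm (T y) * (mloss (T y) * rate2 (T y)))); last first.
    by rewrite ltr_pM2l // mulr_gt0.
  have -> : l2 * dm (T y) * (mloss (T y) * rate2 (T y)) =
    l2 * mloss (T y) * rate2 (T y) * dm (T y) by ring.
  have pos : 0 < l2 * mloss (T y) * rate2 (T y) by rewrite mulr_gt0 // mulr_gt0.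
  by rewrite (ler_pM2l pos).
- by rewrite x0 lexx.
Qed.

(** If it failed, the ratio of the two sides would be an admissible [k] turning the strict
    inequality of [loss_compare_lt] into an equality. *)
Lemma loss_compare x : 0 < x < pi / 2 -> l1 * mloss x <= l2 * mloss (T x).
Proof.
move=> xp; have /andP[x0 xp2] := xp.
have mT := mloss_gt0 (T_itv xp); have mx := mloss_gt0 xp; rewrite leNgt; apply/negP => lt.
have den : 0 < l1 * mloss x by rewrite mulr_gt0.
pose k := l2 * mloss (T x) / (l1 * mloss x).
have k01 : 0 < k < 1.
  by rewrite (divr_gt0 (mulr_gt0 l20 mT) den) /k ltr_pdivrMr // mul1r lt.
have := loss_compare_lt k01 xp.
by rewrite -mulrA divfK ?gt_eqF // subrr ltxx.
Qed.

(** With respect to the angle, [lnamp] has derivative [- 2 sin^2 psi / (c - sin psi cos psi)],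
    nondecreasing in [c = l * mloss], so [loss_compare] orders the losses. The subtracted logarithms
    are the values at 0. *)
Lemma lnamp_compare x : 0 <= x < pi / 2 ->
  lnamp g l1 Q1 S1 x - ln (2 * l1 ^+ 2) <= lnamp g l2 Q2 S2 (T x) - ln (2 * l2 ^+ 2).
Proof.
move=> /andP[x0 xp].
have ln0 l Q S : sturm_pair g l Q S -> lnamp g l Q S 0 = ln (2 * l ^+ 2).
  move=> QS; rewrite /lnamp cos0 ln1 mulr0 add0r dbl0; congr ln.
  have := sturm_pair_S1 QS; have [_ q1 _ _] := QS => s1.
  by rewrite /amp !hornerE /= q1 s1; ring.
pose da l Q S y := - 4 * (sin y / cos y) * (damp g).[dbl y] * S.[dbl y] ^+ 2 /
  (amp l Q S).[dbl y].
pose B y := lnamp g l2 Q2 S2 (T y) - lnamp g l1 Q1 S1 y.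
have TI y : 0 <= y < pi / 2 -> 0 <= T y < pi / 2.
  move=> /andP[]; rewrite le_eqVlt => /predU1P[<- _|y0 yp].
    by rewrite T0 lexx divr_gt0.
  by have /andP[/ltW -> ->] : 0 < T y < pi / 2 by apply: T_itv; rewrite y0.
have DB y : 0 <= y < pi / 2 ->
  is_derive y 1 B (da l2 Q2 S2 (T y) * (rate1 y / rate2 (T y)) - da l1 Q1 S1 y).
  move=> yp; have yp' : 0 <= y <= pi / 2 by case/andP: yp => -> /ltW.
  exact: (is_deriveB (is_derive1_comp (is_derive_lnamp g2 QS2 (TI _ yp)) (DT yp'))
     (is_derive_lnamp g2 QS1 yp)).
suff : B 0 <= B x by rewrite /B T0 !ln0 //; lra.
have [||c] := @MVT_segment R B (fun y => da l2 Q2 S2 (T y) *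
    (rate1 y / rate2 (T y)) - da l1 Q1 S1 y) 0 x x0.
- move=> y; rewrite in_itv /= => /andP[y0 yx]; apply: DB.
  by rewrite ltW // (lt_trans yx).
- apply: derivable_within_continuous => y; rewrite in_itv /= => /andP[y0 yx].
  have yp : 0 <= y < pi / 2 by rewrite y0 (le_lt_trans yx).
  by have [] := DB _ yp.
rewrite in_itv /= => /andP[c0 cx] E; rewrite -subr_ge0 E mulr_ge0 ?subr_ge0 //.
move: c0; rewrite le_eqVlt => /predU1P[<-|c0].
  by rewrite T0 /da sin0 !(mul0r, mulr0).
have cp : 0 < c < pi / 2 by rewrite c0 (le_lt_trans cx).
have cp' : 0 <= c < pi / 2 by case/andP: cp => /ltW -> ->.
have r2 : 0 < rate2 (T c) by exact: psi_rate_gt0.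
have := lnamp_rateE P1 cp'; have := lnamp_rateE P2 (TI _ cp').
rewrite -/(da _ _ _ _) -/(da _ _ _ _) psiT; last by case/andP: cp' => -> /ltW.
move=> E2 E1.
have h1 := dsin_gt0 cp; have h2 := dsin_gt0 (T_itv cp).
have m1 := mloss_gt0 cp; have m2 := mloss_gt0 (T_itv cp).
have e1 : mloss c * da l1 Q1 S1 c = - 4 * sin (psi1 c) ^+ 2.
  by rewrite /mloss mulrAC E1; field; rewrite gt_eqF.
have e2 : mloss (T c) * da l2 Q2 S2 (T c) = - 4 * sin (psi1 c) ^+ 2.
  by rewrite /mloss mulrAC E2; field; rewrite gt_eqF.
(* Clearing the positive denominators reduces the difference of derivatives to
   [8 sin^2 psi (c2 - c1)]. *)
rewrite -subr_ge0 -(pmulr_rge0 _ (mulr_gt0 (mulr_gt0 m1 m2) r2)).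
have -> : mloss c * mloss (T c) * rate2 (T c) *
    (da l2 Q2 S2 (T c) * (rate1 c / rate2 (T c)) - da l1 Q1 S1 c) =
  (mloss (T c) * da l2 Q2 S2 (T c)) * (mloss c * rate1 c) -
  (mloss c * da l1 Q1 S1 c) * (mloss (T c) * rate2 (T c)).
  by field; rewrite gt_eqF.
rewrite e1 e2 rate_loss1 // rate_loss2 //.
have := loss_compare cp; have := sqr_ge0 (sin (psi1 c)).
move: (sin (psi1 c) ^+ 2) (l1 * mloss c) (l2 * mloss (T c)) (_ * cos _) => s a b d s0 ab.
have -> : - 4 * s * (2 * (a - d)) - - 4 * s * (2 * (b - d)) = 8 * (s * (b - a)) by ring.
by rewrite mulr_ge0 // mulr_ge0 // subr_ge0.
Qed.

Lemma crit_compare x : 0 <= x < pi / 2 -> sin (psi1 x) = 0 ->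
  (1 + dbl x) `^ g * `|Q1.[dbl x]| <= (1 + dbl (T x)) `^ g * `|Q2.[dbl (T x)]|.
Proof.
move=> xp s0; have /andP[x0 xp2] := xp.
have Tp : 0 <= T x < pi / 2.
  move: x0; rewrite le_eqVlt => /predU1P[<-|x0]; first by rewrite T0 lexx divr_gt0.
  by have /andP[/ltW -> ->] : 0 < T x < pi / 2 by apply: T_itv; rewrite x0.
have s0' : sin (psi2 (T x)) = 0 by rewrite psiT // x0 ltW.
have [q1 E1] := lnamp_crit QS1 P1 xp s0.
have [q2 E2] := lnamp_crit QS2 P2 Tp s0'.
have := lnamp_compare xp; rewrite E1 E2 => lt.
have cp y : 0 <= y < pi / 2 -> 0 < cos y ^+ 2.
  move=> /andP[y0 yp]; rewrite exprn_gt0 // cos_gt0_pihalf // yp andbT.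
  by rewrite (lt_le_trans _ y0) // oppr_lt0 divr_gt0.
have pw : 0 < (2 : R) `^ g by exact: powR_gt0.
have EE y q : 0 <= y < pi / 2 ->
    (1 + dbl y) `^ g * `|q| = 2 `^ g * ((cos y ^+ 2) `^ g * `|q|).
  by move=> yp; rewrite dblDl powRM ?mulrA // ltW // cp.
rewrite !EE // ler_pM2l //.
rewrite -ler_ln ?posrE ?mulr_gt0 ?normr_gt0 ?powR_gt0 ?cp //; lra.
Qed.

End Compare.
End Matching.

(** * Total variation *)

Section Variation.
Variables (R : realType) (b : R).
Hypothesis b1 : -1 < b.
Implicit Types (Q S : {poly R}) (c d x y : R) (k : nat).
Local Notation mu := lebesgue_measure.

(** For [S = jacobi_aux (b + 1) Q] this is the total variation of [wpoly b Q] on [[c, d]]. *)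
Definition wabs S c d := \int[mu]_(t in `[c, d]) (`|S.[t]| * (1 + t) `^ b).

Let wabs_integrable S c d : -1 <= c -> d <= 1 ->
  mu.-integrable `[c, d] (EFin \o (fun t => `|S.[t]| * (1 + t) `^ b)).
Proof.
move=> c1 d1; have := integrable_norm (integrable_weight b1 S c1 d1).
by apply: eq_integrable => // t _; rewrite /= normrM (ger0_norm (powR_ge0 _ _)).
Qed.

Lemma wabs1 S c : wabs S c c = 0.
Proof. by rewrite /wabs set_itv1 Rintegral_set1. Qed.

Lemma wabsD S c d e : -1 <= c -> c <= d -> d <= e -> e <= 1 ->
  wabs S c d + wabs S d e = wabs S c e.
Proof.
move=> c1 cd de e1; have fi := wabs_integrable S c1 e1.
rewrite [wabs S d e]/wabs -Rintegral_itv_obnd_cbnd; last first.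
  apply: (integrableS _ _ _ fi) => //.
  by apply: subset_itvr; rewrite bnd_simp.
have := Rintegral_itvB fi; move=> /(_ d); rewrite !bnd_simp => <- //.
by rewrite addrC subrK.
Qed.

Lemma wabs_ge Q S c d : S = jacobi_aux (b + 1) Q -> -1 <= c -> c <= d -> d <= 1 ->
  `|wpoly b Q d - wpoly b Q c| <= wabs S c d.
Proof.
move=> SE c1 cd d1; rewrite -(Rintegral_weight b1 c1 cd d1 SE).
apply: le_trans (le_normr_Rintegral _ _) _ => //; first exact: integrable_weight.
rewrite le_eqVlt; apply/orP; left; apply/eqP; apply: eq_Rintegral => t _.
by rewrite normrM (ger0_norm (powR_ge0 _ _)).
Qed.

Lemma wabs_sign Q S c d k : S = jacobi_aux (b + 1) Q -> -1 <= c -> c <= d -> d <= 1 ->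
  (forall t, c <= t <= d -> 0 <= (-1) ^+ k * S.[t]) ->
  wabs S c d = `|wpoly b Q d - wpoly b Q c|.
Proof.
move=> SE c1 cd d1 sgn; rewrite -(Rintegral_weight b1 c1 cd d1 SE).
have s1 : `|(-1) ^+ k| = 1 :> R by rewrite normrX normrN1 expr1n.
rewrite -[RHS]mul1r -[X in _ = X * _]s1 -normrM -RintegralZl //; last exact: (integrable_weight b1 S c1 d1).
have E : \int[mu]_(t in `[c, d]) ((-1) ^+ k * (S.[t] * (1 + t) `^ b)) = wabs S c d.
  apply: eq_Rintegral => t; rewrite inE /= in_itv /= => /sgn St.
  by rewrite mulrA -(ger0_norm St) normrM s1 mul1r.
by rewrite E ger0_norm // Rintegral_ge0 // => t _; rewrite mulr_ge0 ?powR_ge0.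
Qed.

Lemma cosDkpi x k : cos (x + k%:R * pi) = (-1) ^+ k * cos x.
Proof.
elim: k => [|k IH]; first by rewrite mul0r addr0 mul1r.
by rewrite -natr1 mulrDl mul1r addrA cosDpi IH exprS mulN1r mulNr.
Qed.

Lemma sinDkpi x k : sin (x + k%:R * pi) = (-1) ^+ k * sin x.
Proof.
elim: k => [|k IH]; first by rewrite mul0r addr0 mul1r.
by rewrite -natr1 mulrDl mul1r addrA sinDpi IH exprS mulN1r mulNr.
Qed.

Lemma dbl_surj x y t : 0 <= x -> x <= y -> y <= pi / 2 -> dbl y <= t <= dbl x ->
  exists2 z, x <= z <= y & dbl z = t.
Proof.
move=> x0 xy yp /andP[yt tx].
have [||z] := @IVT R (@dbl R) x y t xy.
- by apply: derivable_within_continuous => z _; have [] := is_derive_dbl z.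
- by rewrite (min_r (le_trans yt tx)) (max_l (le_trans yt tx)) yt.
by rewrite in_itv /= => zxy <-; exists z.
Qed.

(** * Signs between successive critical points *)

Section OneFamily.
Variables (l : R) (Q S : {poly R}) (psi : R -> R).
Hypotheses (g2 : 2^-1 < b + 1) (QS : sturm_pair (b + 1) l Q S).
Hypothesis P : pruefer (b + 1) l Q S psi.

Let pi0 : 0 < pi :> R := pi_gt0 R.
Let l0 : 0 < l. Proof. by case: QS. Qed.

Lemma pruefer_le x y : 0 <= x -> x <= y -> y <= pi / 2 -> psi x <= psi y.
Proof.
move=> x0; rewrite le_eqVlt => /predU1P[-> //|xy] yp.
by apply/ltW/(pruefer_mono g2 QS P); have := pi0; lra.
Qed.

Lemma pruefer_surj v : 0 <= v <= psi (pi / 2) -> exists2 x, 0 <= x <= pi / 2 & psi x = v.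
Proof.
move=> /andP[v0 vp]; have [p0 D _ _] := P.
have p2 : 0 <= pi / 2 :> R by rewrite divr_ge0 // ltW.
have [||x] := @IVT R psi 0 (pi / 2) v p2.
- apply: derivable_within_continuous => z; rewrite in_itv /= => /quarter_itv zi.
  by have [] := D _ zi.
- by rewrite p0 (min_l (le_trans v0 vp)) (max_r (le_trans v0 vp)) v0.
by rewrite in_itv /= => xp <-; exists x.
Qed.

Lemma sign_section x y k : 0 <= x -> x <= y -> y <= pi / 2 ->
  k%:R * pi <= psi x -> psi y <= k.+1%:R * pi ->
  forall t, dbl y <= t <= dbl x -> 0 <= (-1) ^+ k * S.[t].
Proof.
move=> x0 xy yp kx ky t /(dbl_surj x0 xy yp)[z /andP[xz zy] <-].
have zp : 0 <= z <= pi / 2 by rewrite (le_trans x0) ?(le_trans zy).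
have kz : k%:R * pi <= psi z by rewrite (le_trans kx) // pruefer_le // (le_trans zy).
have zk : psi z <= k.+1%:R * pi.
  by rewrite (le_trans _ ky) // pruefer_le // (le_trans x0).
(* At [z = 0] the factor [sin z] vanishes and the polar form says nothing about [S]; there [k = 0]
   and [S.[1] = l^2]. *)
move: (zp) => /andP[z0 zp2]; move: z0; rewrite le_eqVlt => /predU1P[zE|z0].
  have [p0 _ _ _] := P.
  have k0 : k = 0%N.
    apply/eqP; rewrite -leqn0 -(ler_nat R) -(ler_pM2r pi0) mul0r.
    by move: kz; rewrite -zE p0.
  by rewrite k0 mul1r -zE dbl0 (sturm_pair_S1 QS) sqr_ge0.
have s0 : 0 < sin z by apply: sin_gt0_pi; rewrite z0; have := pi0; lra.
have [r r0 [_ ES]] := pruefer_polar P zp.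
rewrite -(pmulr_rge0 _ s0) mulrCA ES.
have -> : psi z = (psi z - k%:R * pi) + k%:R * pi by rewrite subrK.
rewrite sinDkpi [r * _]mulrCA mulrA -expr2 sqrr_sign mul1r mulr_ge0 ?(ltW r0) //.
apply: sin_ge0_pi; rewrite subr_ge0 kz lerBlDr.
by move: zk; rewrite -natr1 mulrDl mul1r addrC.
Qed.

Lemma crit_sign x k : 0 <= x < pi / 2 -> psi x = k%:R * pi ->
  0 < (-1) ^+ k * wpoly b Q (dbl x).
Proof.
move=> /andP[x0 xp] E.
have c0 : 0 < cos x by apply: cos_gt0_pihalf; rewrite xp andbT; have := pi0; lra.
have [|r r0 [EQ _]] := pruefer_polar P (x := x); first by rewrite x0 ltW.
have Ek : cos (psi x) = (-1) ^+ k by rewrite E -[_ * pi]add0r cosDkpi cos0 mulr1.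
have lc : 0 < l * cos x by rewrite mulr_gt0.
have w0 : 0 < (1 + dbl x) `^ (b + 1).
  by rewrite powR_gt0 // dblDl mulr_gt0 // exprn_gt0.
rewrite /wpoly mulrCA pmulr_rgt0 // -(pmulr_rgt0 _ lc) mulrCA EQ Ek mulrCA.
by rewrite -expr2 sqrr_sign mulr1.
Qed.

End OneFamily.

Lemma norm_alternate k (u v : R) : 0 < (-1) ^+ k * u -> (-1) ^+ k * v < 0 ->
  `|u - v| = `|u| + `|v|.
Proof.
rewrite -signr_odd; case: (odd k); rewrite /= ?expr1 ?expr0 ?mulN1r ?mul1r.
  rewrite oppr_gt0 oppr_lt0 => u0 v0.
  by rewrite (ltr0_norm u0) (gtr0_norm v0) ltr0_norm; lra.
by move=> u0 v0; rewrite (gtr0_norm u0) (ltr0_norm v0) gtr0_norm; lra.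
Qed.

(** * Comparison of the two variations *)

Section TwoFamilies.
Variables (l1 l2 : R) (Q1 S1 Q2 S2 : {poly R}).
Hypotheses (b23 : 2 / 3 <= b + 1) (l12 : l1 < l2).
Hypotheses (QS1 : sturm_pair (b + 1) l1 Q1 S1) (QS2 : sturm_pair (b + 1) l2 Q2 S2).

Let g2 : 2^-1 < b + 1. Proof. by have := b23; lra. Qed.
Let pi0 : 0 < pi :> R := pi_gt0 R.
Let dblN x : -1 <= dbl x. Proof. by have /andP[] := dbl_itv x. Qed.
Let dblP x : dbl x <= 1. Proof. by have /andP[] := dbl_itv x. Qed.

Let dbl_le x y : 0 <= x -> x <= y -> y <= pi / 2 -> dbl y <= dbl x.
Proof.
move=> x0; rewrite le_eqVlt => /predU1P[-> //|xy] yp.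
exact/ltW/dbl_decr.
Qed.

Let wpoly_norm Q x : `|wpoly b Q (dbl x)| = (1 + dbl x) `^ (b + 1) * `|Q.[dbl x]|.
Proof. by rewrite /wpoly normrM (ger0_norm (powR_ge0 _ _)). Qed.

Lemma wabs_lt : wabs S1 (-1) 1 < wabs S2 (-1) 1.
Proof.
have [psi1 P1] := pruefer_exists g2 QS1; have [psi2 P2] := pruefer_exists g2 QS2.
have [T [T0 psiT Tlt DT]] := matching b23 l12 QS1 QS2 P1 P2.
have [p10 _ _ _] := P1; have [p20 _ _ _] := P2.
have [_ _ SE1 _] := QS1; have [_ _ SE2 _] := QS2.
have p2 : 0 <= pi / 2 :> R by rewrite divr_ge0 // ltW.
have crit x k : 0 <= x < pi / 2 -> psi1 x = k%:R * pi ->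
    `|wpoly b Q1 (dbl x)| <= `|wpoly b Q2 (dbl (T x))|.
  move=> xp E; rewrite !wpoly_norm.
  apply: (crit_compare b23 l12 QS1 QS2 P1 P2 T0 psiT Tlt DT xp).
  by rewrite E -[_ * pi]add0r sinDkpi sin0 mulr0.
have TI x : 0 <= x < pi / 2 -> 0 <= T x < pi / 2.
  move=> /andP[]; rewrite le_eqVlt => /predU1P[<- p|x0 xp]; first by rewrite T0 lexx.
  have /andP[/ltW -> /lt_trans -> //] : 0 < T x < x by rewrite Tlt // x0 ltW.
have psiT' x : 0 <= x < pi / 2 -> psi2 (T x) = psi1 x.
  by move=> /andP[x0 /ltW xp]; rewrite psiT // x0.
have mono1 x y : 0 <= x <= pi / 2 -> 0 <= y <= pi / 2 -> psi1 x < psi1 y -> x < y.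
  move=> /andP[x0 xp] /andP[y0 yp]; apply: contraTT; rewrite -!leNgt => yx.
  exact: (pruefer_le g2 QS1 P1).
have mono2 x y : 0 <= x <= pi / 2 -> 0 <= y <= pi / 2 -> psi2 x < psi2 y -> x < y.
  move=> /andP[x0 xp] /andP[y0 yp]; apply: contraTT; rewrite -!leNgt => yx.
  exact: (pruefer_le g2 QS2 P2).
have W x : 0 <= x < pi / 2 -> 0 <= x <= pi / 2 by move=> /andP[-> /ltW].
have kpi_lt (k : nat) : k%:R * pi < k.+1%:R * pi :> R by rewrite ltr_pM2r // ltr_nat.
(* Between consecutive critical points the first variation is at most the sum of the two extremal
   absolute values. These are dominated by the values of the second function at the matched points,
   whose signs alternate, so that their sum is a lower bound for the second variation. *)
have main k x : 0 <= x < pi / 2 -> psi1 x = k%:R * pi ->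
    wabs S1 (dbl x) 1 <= wabs S2 (dbl (T x)) 1.
  elim: k x => [|k IH] x xp Ex.
    have -> : x = 0.
      apply/eqP; rewrite eq_le; have /andP[x0 _] := xp; rewrite x0 andbT leNgt.
      apply/negP => x1; have := pruefer_mono g2 QS1 P1 (ltrN10 R) x1.
      have /quarter_itv/andP[_ ->] := W _ xp.
      by rewrite p10 Ex mul0r ltxx => /(_ isT).
    by rewrite T0 dbl0 !wabs1.
  have /andP[x0 xp2] := xp.
  have [|y yp Ey] := @pruefer_surj _ _ _ _ P1 (k%:R * pi).
    rewrite mulr_ge0 ?(ltW pi0) //= (le_trans (ltW (kpi_lt k))) // -Ex.
    by apply: (pruefer_le g2 QS1 P1) => //; exact: ltW.
  have yx : y < x by apply: (mono1 _ _ yp (W _ xp)); rewrite Ey Ex.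
  have yp' : 0 <= y < pi / 2 by have /andP[-> _] := yp; rewrite (lt_trans yx).
  have /andP[y0 _] := yp.
  have /andP[Tx0 Txp] := TI _ xp; have /andP[Ty0 Typ] := TI _ yp'.
  have Tyx : T y < T x by apply: (mono2 _ _ (W _ (TI _ yp')) (W _ (TI _ xp))); rewrite !psiT' // Ey Ex.
  rewrite -(@wabsD S1 (dbl x) (dbl y) 1) ?dbl_le ?(ltW yx) ?(ltW xp2) //.
  rewrite -(@wabsD S2 (dbl (T x)) (dbl (T y)) 1) ?dbl_le ?(ltW Tyx) ?(ltW Txp) //.
  apply: lerD; last exact: IH.
  rewrite (@wabs_sign Q1 S1 _ _ k) ?dbl_le ?(ltW yx) ?(ltW xp2) //; last first.
    by apply: (sign_section g2 QS1 P1); rewrite ?Ey ?Ex ?(ltW yx) ?(ltW xp2).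
  apply: le_trans (ler_normB _ _) _.
  apply: le_trans (lerD (crit y k yp' Ey) (crit x k.+1 xp Ex)) _.
  rewrite -(@norm_alternate k).
  - by apply: wabs_ge => //; apply: dbl_le => //; exact: ltW.
  - by apply: (crit_sign QS2 P2); rewrite ?TI // psiT'.
  - have := @crit_sign _ _ _ _ QS2 P2 (T x) k.+1; rewrite TI // psiT' //.
    by rewrite exprS mulN1r mulNr oppr_gt0 => /(_ isT Ex).
(* The factor [cos x] kills the first component at [pi / 2], so the final angle is an odd multiple
   of [pi / 2], hence strictly between two multiples of [pi]. *)
have c0 : cos (psi1 (pi / 2)) = 0.
  have [|r r0 [E _]] := pruefer_polar P1 (x := pi / 2); first by rewrite p2 lexx.
  move/eqP: E; rewrite cos_pihalf mulr0 mul0r eq_sym mulf_eq0 gt_eqF //=.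
  by move/eqP.
set v1 := psi1 (pi / 2) in c0.
have v10 : 0 <= v1 by rewrite -p10; apply: (pruefer_le g2 QS1 P1).
have [k /andP[kv vk]] : exists k : nat, k%:R * pi <= v1 < k.+1%:R * pi.
  exists (Num.truncn (v1 / pi)).
  have := Num.Theory.truncn_itv (divr_ge0 v10 (ltW pi0)).
  by rewrite ler_pdivlMr // ltr_pdivrMr.
have {}kv : k%:R * pi < v1.
  rewrite lt_neqAle kv andbT; apply/eqP => E; move: c0.
  rewrite -E -[_ * pi]add0r cosDkpi cos0 mulr1 => /eqP.
  by rewrite signr_eq0.
have [|x xp Ex] := @pruefer_surj _ _ _ _ P1 (k%:R * pi).
  by rewrite mulr_ge0 ?(ltW pi0) //= ltW.
have xlt : x < pi / 2 by apply: (mono1 _ _ xp); rewrite ?p2 ?lexx // Ex.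
have xp' : 0 <= x < pi / 2 by case/andP: xp => -> _.
have /andP[x0 xp2] := xp'; have /andP[Tx0 Txp] := TI _ xp'.
have v12 : v1 < psi2 (pi / 2).
  by apply: (pruefer_lt b23 l12 QS1 QS2 P1 P2); rewrite lexx divr_gt0.
(* [v] is past the final angle of the first family yet still attained by the second, and stays below
   [k.+1%:R * pi]: [cos] has passed its zero at [v1], so the second function has changed sign at
   [s]. *)
pose v := (v1 + Num.min (psi2 (pi / 2)) (k.+1%:R * pi)) / 2.
have m0 : v1 < Num.min (psi2 (pi / 2)) (k.+1%:R * pi) by rewrite lt_min v12.
have v1v : v1 < v by rewrite /v; lra.
have vm : v < Num.min (psi2 (pi / 2)) (k.+1%:R * pi) by rewrite /v; lra.
move: vm; rewrite lt_min => /andP[vp vk1].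
have [|s sp Es] := @pruefer_surj _ _ _ _ P2 v.
  by rewrite (le_trans v10) ltW.
have slt : s < pi / 2 by apply: (mono2 _ _ sp); rewrite ?p2 ?lexx // Es.
have sp' : 0 <= s < pi / 2 by case/andP: sp => -> _.
have Txs : T x < s.
  by apply: (mono2 _ _ (W _ (TI _ xp')) sp); rewrite psiT' // Es Ex (lt_trans kv).
have cv : (-1) ^+ k * cos v < 0.
  have E (w : R) : (-1) ^+ k * cos w = cos (w - k%:R * pi).
    have := cosDkpi (w - k%:R * pi) k; rewrite subrK => ->.
    by rewrite mulrA -expr2 sqrr_sign mul1r.
  rewrite E -[X in _ < X](mulr0 ((-1) ^+ k)) -c0 E.
  rewrite ltr_cos ?ltrD2r // in_itv /=.
    rewrite subr_ge0 (ltW kv) lerBlDr; move: (ltW vk).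
    by rewrite -natr1 mulrDl mul1r addrC.
  rewrite subr_ge0 (ltW (lt_trans kv v1v)) lerBlDr; move: (ltW vk1).
  by rewrite -natr1 mulrDl mul1r addrC.
have neg : (-1) ^+ k * wpoly b Q2 (dbl s) < 0.
  have /andP[s0 _] := sp.
  have [r r0 [EQ _]] := pruefer_polar P2 sp.
  have cs : 0 < cos s by apply: cos_gt0_pihalf; rewrite slt andbT; have := pi0; lra.
  have l20 : 0 < l2 by case: QS2.
  have w0 : 0 < (1 + dbl s) `^ (b + 1).
    by rewrite powR_gt0 // dblDl mulr_gt0 // exprn_gt0.
  rewrite /wpoly mulrCA pmulr_rlt0 // -(pmulr_rlt0 _ (mulr_gt0 l20 cs)) mulrCA EQ.
  by rewrite Es mulrCA pmulr_rlt0.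
have sgn t : dbl (pi / 2) <= t <= dbl x -> 0 <= (-1) ^+ k * S1.[t].
  by apply: (sign_section g2 QS1 P1); rewrite ?Ex //; exact: ltW.
(* From its last critical point the first function runs monotonically to 0 at -1. The second runs
   from a value at least as large in absolute value to one of opposite sign at [s], and this
   overshoot makes the inequality strict. *)
rewrite -(@wabsD S1 (-1) (dbl x) 1) // -(@wabsD S2 (-1) (dbl (T x)) 1) //.
apply: ltr_leD; last exact: main Ex.
rewrite (@wabs_sign Q1 S1 _ _ k) //; last first.
  by move=> t tx; apply: sgn; rewrite dbl_pihalf.
rewrite wpolyN1 // subr0 (le_lt_trans (crit x k xp' Ex)) //.
rewrite -(@wabsD S2 (-1) (dbl s) (dbl (T x))) ?dbl_le ?(ltW Txs) ?(ltW slt) //.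
apply: (@lt_le_trans _ _ (0 + (`|wpoly b Q2 (dbl (T x)) - wpoly b Q2 (dbl s)|))).
  rewrite add0r (@norm_alternate k) //.
    by rewrite ltrDl normr_gt0; apply: contraTneq neg => ->; rewrite mulr0 ltxx.
  by apply: (crit_sign QS2 P2); rewrite ?TI // psiT'.
apply: lerD.
  by apply: Rintegral_ge0 => t _; rewrite mulr_ge0 ?powR_ge0.
by apply: wabs_ge => //; apply: dbl_le => //; exact: ltW.
Qed.

End TwoFamilies.
End Variation.

Theorem theorem5p2 (R : realType) (beta : R) (hbeta : - (1 / 3) <= beta) :
  forall n : nat, ell beta n < ell beta n.+1.
Proof.
move=> n; have b1 : -1 < beta by lra.
have b23 : 2 / 3 <= beta + 1 by lra.
have mb m : 0 < m%:R + (beta + 1) by rewrite ltr_wpDl //; lra.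
pose l m := Num.sqrt ((m%:R + 1) * (m%:R + (beta + 1))).
have lp m : 0 < (m%:R + 1) * (m%:R + (beta + 1)) by rewrite mulr_gt0 // natr1.
have pair m : sturm_pair (beta + 1) (l m) (jacobi 0 (beta + 1) m)
    (jacobi_aux (beta + 1) (jacobi 0 (beta + 1) m)).
  split=> //; first by rewrite sqrtr_gt0.
    exact: jacobi0_at1.
  by rewrite /l sqr_sqrtr ?ltW // jacobi_aux_deriv.
rewrite !ellE // ltr_pM2l ?invr_gt0 ?powR_gt0 //.
apply: (wabs_lt b1 b23 _ (pair n) (pair n.+1)).
rewrite ltr_sqrt // -[n.+1%:R]natr1; have := mb n; have : 0 <= n%:R :> R by [].
move: (n%:R) => x x0 xb; rewrite ltr_pM //; lra.
Qed.
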